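(* Let $\theta$ be a real number with $|\theta|<\pi$. Then the following four identities hold: \[ \pi^2\sum_{n=1}^\infty \frac{\cosh(n\theta)}{n^2\sinh^2(\pi n)} - \pi^2\sum_{n=1}^\infty \frac{\cos(n\theta)}{n^2\sinh^2(\pi n)} - \theta\pi\sum_{n=1}^\infty \frac{\coth(\pi n)\sin(n\theta)}{n^2} - 2\pi\sum_{n=1}^\infty \frac{\coth(\pi n)\cos(n\theta)}{n^3} + \frac{\theta^4}{48} - \theta^2\zeta(2) + 7\zeta(4) = 0, \] \[ \pi^2\sum_{n=1}^\infty \frac{\cosh\left(\frac{2n-1}{2}\theta\right)}{(2n-1)^2\cosh^2\left(\frac{2n-1}{2}\pi\right)} - \pi^2\sum_{n=1}^\infty \frac{\cos\left(\frac{2n-1}{2}\theta\right)}{(2n-1)^2\cosh^2\left(\frac{2n-1}{2}\pi\right)} + \theta\pi\sum_{n=1}^\infty \frac{\tanh\left(\frac{2n-1}{2}\pi\right)\sin\left(\frac{2n-1}{2}\theta\right)}{(2n-1)^2} + 4\pi\sum_{n=1}^\infty \frac{\tanh\left(\frac{2n-1}{2}\pi\right)\cos\left(\frac{2n-1}{2}\theta\right)}{(2n-1)^3} - \frac{\pi^4}{8} = 0, \] \[ \pi^2\sum_{n=1}^\infty \frac{\cosh(n\theta)}{n^2\cosh^2(\pi n)} + 4\pi^2\sum_{n=1}^\infty \frac{\cos\left(\frac{2n-1}{2}\theta\right)}{(2n-1)^2\sinh^2\left(\frac{2n-1}{2}\pi\right)} + 4\theta\pi\sum_{n=1}^\infty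 \frac{\coth\left(\frac{2n-1}{2}\pi\right)\sin\left(\frac{2n-1}{2}\theta\right)}{(2n-1)^2} + 16\pi\sum_{n=1}^\infty \frac{\coth\left(\frac{2n-1}{2}\pi\right)\cos\left(\frac{2n-1}{2}\theta\right)}{(2n-1)^3} + \left(\frac{\theta^2}{4}-4\zeta(2)\right)\pi^2 = 0, \] \[ \pi^2\sum_{n=1}^\infty \frac{\cos(n\theta)}{n^2\cosh^2(\pi n)} + 4\pi^2\sum_{n=1}^\infty \frac{\cosh\left(\frac{2n-1}{2}\theta\right)}{(2n-1)^2\sinh^2\left(\frac{2n-1}{2}\pi\right)} - \theta\pi\sum_{n=1}^\infty \frac{\tanh(\pi n)\sin(n\theta)}{n^2} - 2\pi\sum_{n=1}^\infty \frac{\tanh(\pi n)\cos(n\theta)}{n^3} - \frac{\pi^2\theta^2}{4} = 0. \]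
   Context: $\zeta(s)=\sum_{n\ge1}n^{-s}$ is the Riemann zeta function; in particular $\zeta(2)=\pi^2/6$ and $\zeta(4)=\pi^4/90$. *)

(* Defs.v *)
From Stdlib Require Export Reals.
From Coquelicot Require Export Coquelicot.

Open Scope R_scope.

Definition coth (x : R) : R := cosh x / sinh x.

(* [is_sum1 f l]: the series f 1 + f 2 + f 3 + ... converges, with sum l;
   f 0 is ignored. *)
Definition is_sum1 (f : nat -> R) (l : R) : Prop :=
  is_series (fun k : nat => f (S k)) l.

(* The Riemann zeta function on real arguments s > 1, where the series
   converges; for s <= 1 the value of [zeta s] is meaningless. *)
Definition zeta (s : R) : R :=
  Series (fun k : nat => Rpower (INR (S k)) (- s)).

(* Main.v *)
(** Contour integration of [pi^3 cot (pi z) cosh (theta z) / (z^2 sinh^2 (pi z))] and its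
    variants is replaced by summing a partial fraction expansion over a lattice. With
      [residue_term x k t
         = 2 cos (k t) (x^2 - k^2) / (x^2 + k^2)^2 - 2 t k sin (k t) / (x^2 + k^2)],
    the sum over the integers [k >= 1] is [pi^2 cosh (x t) / sinh^2 (pi x) - 1 / x^2], and by
    homogeneity (odd terms = all terms - even terms) the sum over the positive half-integers is
    [- pi^2 cosh (x t) / cosh^2 (pi x)]. Dividing by [x^2], summing over the integers or
    half-integers [x] and exchanging the two sums (Tannery) gives the four identities: the inner
    sums over [x] are the classical [coth] and [tanh] expansions, and what remains are Bernoulli
    polynomials.

    The expansion itself comes from an ODE. After splitting off a conditionally convergent
    Bernoulli part, [x^-2] times the sum is an absolutely convergent series [K (t)] with
    [K'' = x^2 K - 2 (pi^2 / 6 - t^2 / 4)] on [(0, 2 pi)], [K' (0) = 0] and [K (2 pi) = K (0)],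
    which determines it; the [coth] expansion is the value of [K'] at [2 pi]. *)

Require Import Defs.
From Stdlib Require Import Reals Lra Lia.
From Coquelicot Require Import Coquelicot.
Open Scope R_scope.

(** * Dominated series *)

Lemma ex_series_le_Rabs (a b : nat -> R) :
  (forall n, Rabs (a n) <= b n) -> ex_series b -> ex_series a.
Proof. intros H Hb. exact (ex_series_le (V := R_CompleteNormedModule) a b H Hb). Qed.

Lemma Series_Rabs_le (a b : nat -> R) :
  (forall n, Rabs (a n) <= b n) -> ex_series b -> Rabs (Series a) <= Series b.
Proof.
intros H Hb.
assert (Ha : ex_series (fun n => Rabs (a n))).
{ apply ex_series_le_Rabs with b; [|exact Hb]. intros n. rewrite Rabs_Rabsolu. apply H. }
apply Rle_trans with (1 := Series_Rabs a Ha).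
apply Series_le; [|exact Hb].
intros n; split; [apply Rabs_pos|apply H].
Qed.

Lemma filterlim_sum_n {T : Type} (F : (T -> Prop) -> Prop) {FF : Filter F}
    (f : T -> nat -> R) (g : nat -> R) (N : nat) :
  (forall m, filterlim (fun t => f t m) F (locally (g m))) ->
  filterlim (fun t => sum_n (f t) N) F (locally (sum_n g N)).
Proof.
intros H. induction N as [|N IH].
- rewrite sum_O. apply filterlim_ext with (fun t => f t 0%nat).
  intros t; now rewrite sum_O. apply H.
- rewrite sum_Sn. apply filterlim_ext with (fun t => plus (sum_n (f t) N) (f t (S N))).
  intros t; now rewrite sum_Sn.
  eapply filterlim_comp_2; [exact IH | apply H | exact (filterlim_plus (V := R_NormedModule) (sum_n g N) (g (S N)))].
Qed.

(* Tannery's theorem. *)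
Lemma dominated_series {T : Type} (F : (T -> Prop) -> Prop) {FF : ProperFilter F}
    (f : T -> nat -> R) (g B : nat -> R) :
  F (fun t => forall m, Rabs (f t m) <= B m) -> ex_series B ->
  (forall m, filterlim (fun t => f t m) F (locally (g m))) ->
  ex_series g /\ filterlim (fun t => Series (f t)) F (locally (Series g)).
Proof.
intros HB exB Hlim.
assert (HgB : forall m, Rabs (g m) <= B m).
{ intros m.
  apply (filterlim_le (F := F) (fun t => Rabs (f t m)) (fun _ => B m) (Rabs (g m)) (B m)).
  - apply filter_imp with (2 := HB). intros t Ht. apply Ht.
  - eapply filterlim_comp; [apply Hlim|]. apply (continuous_Rabs (g m)).
  - apply filterlim_const. }
assert (exg : ex_series g) by (apply ex_series_le_Rabs with B; assumption).
split; [exact exg|].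
apply filterlim_locally. intros eps.
assert (e3 : 0 < eps / 3) by (generalize (cond_pos eps); lra).
destruct (Series_correct _ exB (ball (Series B) (eps/3)) ltac:(exists (mkposreal _ e3); intros y Hy; exact Hy)) as [N HN].
assert (Htail : Rabs (Series (fun m => B (S N + m)%nat)) < eps / 3).
{ specialize (HN N (Nat.le_refl _)). unfold ball in HN; simpl in HN.
  unfold AbsRing_ball, abs, minus, plus, opp in HN; simpl in HN.
  assert (E := Series_incr_n B (S N) ltac:(lia) exB). simpl in E.
  rewrite <- sum_n_Reals in E.
  simpl. replace (Series (fun m : nat => B (S (N + m)))) with (- (sum_n B N + - Series B)) by (rewrite E; ring).
  now rewrite Rabs_Ropp. }
(* The same [N] serves every [f t] and [g], as only the tail of [B] enters. Two tails and one
   difference of partial sums then cost [eps / 3] each. *)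
assert (tail_le : forall h : nat -> R, (forall m, Rabs (h m) <= B m) ->
   Rabs (Series h - sum_n h N) < eps / 3).
{ intros h Hh. assert (exh : ex_series h) by (apply ex_series_le_Rabs with B; assumption).
  rewrite (Series_incr_n h (S N) ltac:(lia) exh). simpl pred. rewrite <- sum_n_Reals.
  replace (sum_n h N + Series (fun k : nat => h (S N + k)%nat) - sum_n h N)
    with (Series (fun k : nat => h (S N + k)%nat)) by ring.
  apply Rle_lt_trans with (2 := Htail). apply Rle_trans with (2 := Rle_abs _).
  apply Series_Rabs_le; [intros n; apply Hh|]. now apply -> (ex_series_incr_n B (S N)). }
assert (Hs := filterlim_sum_n F f g N Hlim).
assert (Hs' := proj1 (filterlim_locally _ _) Hs (mkposreal _ e3)).
generalize (filter_and _ _ HB Hs'). apply filter_imp. intros t [Ht1 Ht2].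
unfold ball in Ht2 |- *; simpl in Ht2 |- *.
unfold AbsRing_ball, abs, minus, plus, opp in Ht2 |- *; simpl in Ht2 |- *.
assert (H1 := tail_le _ Ht1). assert (H2 := tail_le _ HgB).
apply Rabs_def2 in H1. apply Rabs_def2 in H2. apply Rabs_def2 in Ht2.
apply Rabs_def1; lra.
Qed.

Lemma continuous_Series (f : nat -> R -> R) (M : nat -> R) (a r : R) :
  0 < r ->
  (forall n, continuous (f n) a) ->
  (forall n s, Rabs (s - a) < r -> Rabs (f n s) <= M n) -> ex_series M ->
  continuous (fun s => Series (fun n => f n s)) a.
Proof.
intros Hr Hc HM exM.
apply (dominated_series (locally a) (fun s n => f n s) (fun n => f n a) M); auto.
exists (mkposreal r Hr). intros y Hy m. apply HM. exact Hy.
Qed.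

(** Tannery's theorem applied to the difference quotients as [h] tends to [0]: by the mean value
    theorem each quotient is a value of [f' n] near [a], hence bounded by [M n]. *)
Lemma is_derive_Series (f f' : nat -> R -> R) (M : nat -> R) (a r : R) :
  0 < r ->
  (forall n s, Rabs (s - a) < r -> is_derive (f n) s (f' n s)) ->
  (forall n s, Rabs (s - a) < r -> Rabs (f' n s) <= M n) -> ex_series M ->
  (forall s, Rabs (s - a) < r -> ex_series (fun n => f n s)) ->
  is_derive (fun s => Series (fun n => f n s)) a (Series (fun n => f' n a)).
Proof.
intros Hr Hd HM exM exf.
assert (Ha : forall h, Rabs h < r -> Rabs (a + h - a) < r).
{ intros h Hh. now replace (a + h - a) with h by ring. }
destruct (dominated_series (Rbar_locally' (Finite 0)) (fun h n => (f n (a + h) - f n a) / h)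
   (fun n => f' n a) M) as [_ Hlim]; [| exact exM | |].
- exists (mkposreal r Hr). intros h Hh Hh0 n.
  assert (Hhr : Rabs h < r).
  { unfold ball in Hh; simpl in Hh; unfold AbsRing_ball, abs, minus, plus, opp in Hh; simpl in Hh.
    now replace h with (h + - 0) by ring. }
  destruct (MVT_gen (f n) a (a + h) (f' n)) as [c [Hc1 Hc2]].
  + intros s Hs. apply Hd. apply Rabs_def2 in Hhr. apply Rabs_def1;
    revert Hs; unfold Rmin, Rmax; destruct (Rle_dec a (a + h)); lra.
  + intros s Hs. apply continuity_pt_filterlim.
    apply (ex_derive_continuous (f n)). exists (f' n s). apply Hd. apply Rabs_def2 in Hhr. apply Rabs_def1;
    revert Hs; unfold Rmin, Rmax; destruct (Rle_dec a (a + h)); lra.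
  + rewrite Hc2. replace (f' n c * (a + h - a) / h) with (f' n c) by (field; exact Hh0).
    apply HM. apply Rabs_def2 in Hhr. apply Rabs_def1;
    revert Hc1; unfold Rmin, Rmax; destruct (Rle_dec a (a + h)); lra.
- intros n. assert (D := Hd n a ltac:(rewrite Rminus_diag, Rabs_R0; trivial)).
  apply is_derive_Reals in D. apply filterlim_locally. intros eps.
  destruct (D eps (cond_pos eps)) as [d Hd']. exists d. intros h Hh Hh0. apply Hd'; [exact Hh0|].
  unfold ball in Hh; simpl in Hh; unfold AbsRing_ball, abs, minus, plus, opp in Hh; simpl in Hh.
  now replace h with (h + - 0) by ring.
- apply is_derive_Reals. intros eps Heps.
  destruct (proj1 (filterlim_locally _ _) Hlim (mkposreal eps Heps)) as [d Hd'].
  assert (Hm : 0 < Rmin d r) by (apply Rmin_pos; [apply cond_pos|exact Hr]).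
  exists (mkposreal _ Hm). intros h Hh0 Hh. simpl in Hh.
  assert (Hh1 : Rabs h < d) by (apply Rlt_le_trans with (1 := Hh); apply Rmin_l).
  assert (Hh2 : Rabs h < r) by (apply Rlt_le_trans with (1 := Hh); apply Rmin_r).
  specialize (Hd' h).
  rewrite <- Series_minus by (apply exf; rewrite ?Rminus_diag, ?Rabs_R0; auto).
  unfold Rdiv. rewrite Rmult_comm, <- Series_scal_l.
  rewrite (Series_ext _ (fun n => (f n (a + h) - f n a) / h)) by (intros n; unfold Rdiv; ring).
  apply Hd'; [|exact Hh0].
  unfold ball; simpl; unfold AbsRing_ball, abs, minus, plus, opp; simpl.
  now replace (h + - 0) with h by ring.
Qed.

(** * The sawtooth series *)

Lemma INR_S_ge_1 (m : nat) : 1 <= INR (S m).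
Proof. rewrite S_INR. generalize (pos_INR m). lra. Qed.

Lemma is_series_Reals_lim (a : nat -> R) (l : R) :
  is_series a l <-> is_lim_seq (sum_n a) l.
Proof. split; intros H; exact H. Qed.

(** This lemma and the next ones restate general facts with the ring operations of [R] visible, so
    that [ring], [field] and rewriting apply to the sums directly. *)
Lemma is_series_ext_R (a b : nat -> R) (l : R) :
  (forall n, a n = b n) -> is_series a l -> is_series b l.
Proof. exact (is_series_ext a b l). Qed.

Lemma is_series_scal_R (c : R) (a : nat -> R) (l : R) :
  is_series a l -> is_series (fun n => c * a n) (c * l).
Proof. exact (is_series_scal_l (K := R_AbsRing) (V := R_NormedModule) c a l). Qed.

Lemma is_series_plus_R (a b : nat -> R) (la lb : R) :
  is_series a la -> is_series b lb -> is_series (fun n => a n + b n) (la + lb).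
Proof. exact (is_series_plus a b la lb). Qed.

Lemma is_series_minus_R (a b : nat -> R) (la lb : R) :
  is_series a la -> is_series b lb -> is_series (fun n => a n - b n) (la - lb).
Proof. exact (is_series_minus a b la lb). Qed.

Lemma sum_Sn_R (a : nat -> R) (n : nat) : sum_n a (S n) = sum_n a n + a (S n).
Proof. exact (sum_Sn a n). Qed.

Lemma ex_series_scal_R (c : R) (a : nat -> R) :
  ex_series a -> ex_series (fun n => c * a n).
Proof. intros H. exact (ex_series_scal_l c a H). Qed.

(** Comparison with the telescoping series of [2 * (1 / k - 1 / (k + 1))]. *)
Lemma ex_series_inv_sq : ex_series (fun m => / INR (S m) ^ 2).
Proof.
apply ex_series_le_Rabs with (fun m => 2 * (/ INR (S m) - / INR (S (S m)))).
- intros m. assert (H := INR_S_ge_1 m). rewrite (S_INR (S m)).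
  set (k := INR (S m)) in *.
  rewrite Rabs_pos_eq by (left; apply Rinv_0_lt_compat; nra).
  apply Rmult_le_reg_l with (k ^ 2 * (k + 1)); [nra|]. field_simplify; nra.
- apply ex_series_scal_R. exists (1 - 0). apply is_series_Reals_lim.
  apply is_lim_seq_ext with (fun N => 1 - / INR (S (S N))).
  + intros N. induction N as [|N IH].
    * rewrite sum_O. simpl. lra.
    * rewrite sum_Sn_R, <- IH. lra.
  + apply is_lim_seq_minus'; [apply is_lim_seq_const|].
    apply is_lim_seq_incr_1 with (u := fun N => / INR (S N)).
    apply is_lim_seq_incr_1 with (u := fun N => / INR N).
    apply (is_lim_seq_inv INR p_infty); [apply is_lim_seq_INR|discriminate].
Qed.

Lemma ex_series_sq_bound (C : R) (a : nat -> R) :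
  (forall m, Rabs (a m) <= C / INR (S m) ^ 2) -> ex_series a.
Proof.
intros H. apply ex_series_le_Rabs with (1 := H).
apply ex_series_scal_R, ex_series_inv_sq.
Qed.

Lemma inv_pow_le_inv_sq (m p : nat) : / INR (S m) ^ (p + 2) <= / INR (S m) ^ 2.
Proof.
assert (H := INR_S_ge_1 m). apply Rinv_le_contravar; [nra|].
rewrite pow_add. assert (1 <= INR (S m) ^ p) by now apply pow_R1_Rle. nra.
Qed.

(** Telescoping of [2 sin (t / 2) cos (k t) = sin ((k + 1 / 2) t) - sin ((k - 1 / 2) t)]. The last
    frequency is [k = N + 1], whence [N + 3 / 2]. *)
Lemma dirichlet_kernel (t : R) (N : nat) :
  2 * sin (t / 2) * sum_n (fun m => cos (INR (S m) * t)) N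
  = sin ((INR N + 3 / 2) * t) - sin (t / 2).
Proof.
induction N as [|N IH].
- rewrite sum_O. simpl INR.
  replace ((0 + 3 / 2) * t) with (t + t / 2) by field.
  replace (sin (t / 2)) with (sin (t - t / 2)) at 2 by (f_equal; field).
  rewrite sin_plus, sin_minus, Rmult_1_l. ring.
- rewrite sum_Sn_R, Rmult_plus_distr_l, IH.
  rewrite (S_INR N), (S_INR (S N)), (S_INR N).
  replace ((INR N + 1 + 3 / 2) * t) with ((INR N + 1 + 1) * t + t / 2) by field.
  replace ((INR N + 3 / 2) * t) with ((INR N + 1 + 1) * t - t / 2) by field.
  rewrite sin_plus, sin_minus. ring.
Qed.

Definition sin_sum_defect (N : nat) (t : R) : R :=
  sum_n (fun m => sin (INR (S m) * t) / INR (S m)) N - (PI - t) / 2.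

Lemma sin_half_pos (t : R) : 0 < t < 2 * PI -> 0 < sin (t / 2).
Proof. intros H. apply sin_gt_0; lra. Qed.

(** The slope of the sawtooth contributes [1 / 2], which absorbs the [- sin (t / 2)] of the kernel
    sum and leaves a single oscillating term. *)
Lemma is_derive_sin_sum_defect (N : nat) (t : R) : 0 < t < 2 * PI ->
  is_derive (sin_sum_defect N) t (sin ((INR N + 3 / 2) * t) / (2 * sin (t / 2))).
Proof.
intros Ht. assert (Hs := sin_half_pos t Ht).
replace (sin ((INR N + 3 / 2) * t) / (2 * sin (t / 2)))
  with (sum_n (fun m => cos (INR (S m) * t)) N - (- / 2)).
- apply (is_derive_minus (V := R_NormedModule)).
  + apply (is_derive_sum_n (V := R_NormedModule) (fun m s => sin (INR (S m) * s) / INR (S m)) N t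
      (fun m => cos (INR (S m) * t))).
    intros m _. generalize (INR_S_ge_1 m). generalize (INR (S m)). intros k Hk.
    auto_derive; [trivial|]. field. lra.
  + auto_derive; [trivial|]. field.
- apply Rmult_eq_reg_l with (2 * sin (t / 2)); [|lra].
  rewrite Rmult_minus_distr_l, dirichlet_kernel. field. lra.
Qed.

Lemma sin_INR_PI (m : nat) : sin (INR m * PI) = 0.
Proof. apply sin_eq_0_1. exists (Z.of_nat m). now rewrite INR_IZR_INZ. Qed.

(** [sin (z / 2)] is [cos (|z - PI| / 2)], which decreases with the distance to [PI]. A bound at [t]
    thus controls every point between [PI] and [t]. *)
Lemma sin_half_ge (s t : R) : 0 < t < 2 * PI -> Rabs (s - PI) <= Rabs (t - PI) ->
  sin (t / 2) <= sin (s / 2).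
Proof.
intros Ht Hs.
assert (E : forall z, sin (z / 2) = cos (Rabs (z - PI) / 2)).
{ intros z. unfold Rabs. destruct (Rcase_abs (z - PI)).
  replace (- (z - PI) / 2) with (PI / 2 - z / 2) by field. now rewrite cos_shift.
  replace ((z - PI) / 2) with (- (PI / 2 - z / 2)) by field. now rewrite cos_neg, cos_shift. }
rewrite !E. assert (Rabs (t - PI) < PI) by (apply Rabs_def1; lra).
generalize (Rabs_pos (s - PI)) (Rabs_pos (t - PI)); intros.
apply cos_decr_1; lra.
Qed.

Lemma between_PI (s t : R) : Rmin PI t <= s <= Rmax PI t -> Rabs (s - PI) <= Rabs (t - PI).
Proof.
unfold Rmin, Rmax, Rabs.
destruct (Rle_dec PI t), (Rcase_abs (s - PI)), (Rcase_abs (t - PI)); lra.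
Qed.

(* Integrating the Dirichlet kernel by parts gains the factor [1 / N]. *)
Lemma sin_sum_defect_bound (N : nat) (t : R) : 0 < t < 2 * PI ->
  Rabs (sin_sum_defect N t) <= (1 + PI) / sin (t / 2) ^ 2 / (INR N + 3 / 2).
Proof.
intros Ht. assert (Hs := sin_half_pos t Ht). assert (HN := pos_INR N).
set (w := INR N + 3 / 2) in *. set (s0 := sin (t / 2)) in *.
(* The added quotient is the boundary term of the integration by parts: its derivative cancels the
   oscillating derivative of the defect and leaves [H'], which carries the factor [1 / w]. *)
set (H := fun u => sin_sum_defect N u + cos (w * u) / (2 * w * sin (u / 2))).
set (H' := fun u => - cos (w * u) * cos (u / 2) / (4 * w * sin (u / 2) ^ 2)).
assert (Hd : forall u, 0 < u < 2 * PI -> is_derive H u (H' u)).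
{ intros u Hu. assert (Hsu := sin_half_pos u Hu).
  unfold H, H'.
  replace (- cos (w * u) * cos (u / 2) / (4 * w * sin (u / 2) ^ 2)) with
   (sin (w * u) / (2 * sin (u / 2)) +
     (- sin (w * u) / (2 * sin (u / 2)) - cos (w * u) * cos (u / 2) / (4 * w * sin (u / 2) ^ 2)))
   by (field; unfold w; lra).
  apply (is_derive_plus (V := R_NormedModule)); [now apply is_derive_sin_sum_defect|].
  auto_derive; [unfold w; nra|]. replace (u * / 2) with (u / 2) by reflexivity.
  field. unfold w; lra. }
(* [PI] is a convenient base point: all the sines vanish there, and [w * PI] is an odd multiple of
   [PI / 2], so the boundary term vanishes too. *)
assert (HPI : H PI = 0).
{ unfold H, sin_sum_defect. rewrite (sum_n_ext _ (fun _ => 0)).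
  - rewrite sum_n_const. unfold w. replace ((INR N + 3 / 2) * PI) with (INR (S N) * PI + PI / 2)
      by (rewrite S_INR; field).
    rewrite cos_plus, cos_PI2, sin_INR_PI. unfold Rdiv. ring.
  - intros m. rewrite sin_INR_PI. apply Rmult_0_l. }
assert (Hpt : forall u, Rmin PI t <= u <= Rmax PI t -> 0 < u < 2 * PI).
{ intros u Hu. revert Hu. unfold Rmin, Rmax; destruct (Rle_dec PI t); generalize PI_RGT_0; lra. }
destruct (MVT_gen H PI t H') as [c [Hc1 Hc2]].
- intros u Hu. apply Hd, Hpt. lra.
- intros u Hu. apply continuity_pt_filterlim, (ex_derive_continuous H).
  exists (H' u). now apply Hd, Hpt.
- assert (Hc := Hpt c Hc1). assert (Hsc := sin_half_ge c t Ht (between_PI c t Hc1)).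
  fold s0 in Hsc.
  assert (s0 <= 1) by apply SIN_bound.
  assert (Hpi : Rabs (t - PI) <= PI) by (apply Rabs_le; lra).
  assert (Hb1 : Rabs (H' c) <= 1 / (s0 ^ 2 * w)).
  { unfold H', Rdiv. rewrite !Rabs_mult, Rabs_Ropp.
    assert (Rabs (cos (w * c)) <= 1) by (apply Rabs_le, COS_bound).
    assert (Rabs (cos (c / 2)) <= 1) by (apply Rabs_le, COS_bound).
    assert (Rabs (cos (w * c)) * Rabs (cos (c / 2)) <= 1 * 1)
     by (apply Rmult_le_compat; auto using Rabs_pos).
    assert (0 < 4 * w * sin (c / 2) ^ 2) by (unfold w; nra).
    apply Rmult_le_compat; [apply Rmult_le_pos; apply Rabs_pos|apply Rabs_pos|lra|].
    rewrite Rabs_inv, (Rabs_pos_eq (4 * w * _)) by lra.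
    apply Rinv_le_contravar; [unfold w; nra|].
    assert (s0 ^ 2 <= sin (c / 2) ^ 2) by (apply pow_incr; lra). unfold w; nra. }
  assert (Hb2 : Rabs (cos (w * t) / (2 * w * s0)) <= 1 / (s0 ^ 2 * w)).
  { unfold Rdiv. rewrite Rabs_mult.
    assert (Rabs (cos (w * t)) <= 1) by (apply Rabs_le, COS_bound).
    assert (0 < 2 * w * s0) by (unfold w; nra).
    apply Rmult_le_compat; [apply Rabs_pos|apply Rabs_pos|lra|].
    rewrite Rabs_inv, (Rabs_pos_eq (2 * w * _)) by lra.
    assert (0 < w * s0) by lra.
    apply Rinv_le_contravar; [replace (s0 ^ 2 * w) with (w * s0 * s0) by ring|]; nra. }
  replace (sin_sum_defect N t) with (H' c * (t - PI) - cos (w * t) / (2 * w * s0))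
   by (rewrite HPI, Rminus_0_r in Hc2; rewrite <- Hc2; unfold H; fold s0; ring).
  apply Rle_trans with (Rabs (H' c * (t - PI)) + Rabs (cos (w * t) / (2 * w * s0))).
  { unfold Rminus. eapply Rle_trans; [apply Rabs_triang|]. rewrite Rabs_Ropp. lra. }
  rewrite Rabs_mult.
  assert (Rabs (H' c) * Rabs (t - PI) <= 1 / (s0 ^ 2 * w) * PI)
    by (apply Rmult_le_compat; auto using Rabs_pos).
  replace ((1 + PI) / s0 ^ 2 / w) with (1 / (s0 ^ 2 * w) * PI + 1 / (s0 ^ 2 * w)); [lra|].
  field. unfold w; lra.
Qed.

Lemma is_lim_seq_div_affine (C : R) : is_lim_seq (fun N => C / (INR N + 3 / 2)) 0.
Proof.
replace (Finite 0) with (Rbar_mult (Finite C) (Finite 0)) by (simpl; f_equal; ring).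
apply is_lim_seq_scal_l.
apply (is_lim_seq_inv (fun N => INR N + 3 / 2) p_infty); [|discriminate].
apply is_lim_seq_plus with p_infty (3 / 2);
 [apply is_lim_seq_INR|apply is_lim_seq_const|reflexivity].
Qed.

Lemma is_lim_seq_Rabs_0 (u remainder_sum : nat -> R) :
  (forall n, Rabs (u n) <= remainder_sum n) -> is_lim_seq remainder_sum 0 -> is_lim_seq u 0.
Proof.
intros H Hv. apply is_lim_seq_abs_0.
apply is_lim_seq_le_le with (fun _ => 0) remainder_sum; [|apply is_lim_seq_const|exact Hv].
intros n; split; [apply Rabs_pos|apply H].
Qed.

Lemma is_series_sin_div (t : R) : 0 < t < 2 * PI ->
  is_series (fun m => sin (INR (S m) * t) / INR (S m)) ((PI - t) / 2).
Proof.
intros Ht.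
apply is_series_Reals_lim.
apply is_lim_seq_ext with (fun N => sin_sum_defect N t + (PI - t) / 2).
{ intros N. unfold sin_sum_defect. ring. }
replace (Finite ((PI - t) / 2)) with (Finite (0 + (PI - t) / 2)) by (f_equal; ring).
apply is_lim_seq_plus'; [|apply is_lim_seq_const].
apply is_lim_seq_Rabs_0 with (2 := is_lim_seq_div_affine ((1 + PI) / sin (t / 2) ^ 2)).
intros N. now apply sin_sum_defect_bound.
Qed.

(** * Bernoulli polynomials *)

Lemma Rabs_cos_le (x : R) : Rabs (cos x) <= 1.
Proof. apply Rabs_le, COS_bound. Qed.

Lemma Rabs_sin_le (x : R) : Rabs (sin x) <= 1.
Proof. apply Rabs_le, SIN_bound. Qed.

Lemma cos_INR_2PI (m : nat) : cos (INR m * (2 * PI)) = 1.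
Proof.
replace (INR m * (2 * PI)) with (0 + 2 * INR m * PI) by ring.
now rewrite cos_period, cos_0.
Qed.

Lemma sin_INR_2PI (m : nat) : sin (INR m * (2 * PI)) = 0.
Proof.
replace (INR m * (2 * PI)) with (0 + 2 * INR m * PI) by ring.
now rewrite sin_period, sin_0.
Qed.

Lemma eq_of_zero_derive (f : R -> R) (a b : R) : a <= b ->
  (forall x, a < x < b -> is_derive f x 0) ->
  (forall x, a <= x <= b -> continuous f x) -> f b = f a.
Proof.
intros Hab Hd Hc. destruct (MVT_gen f a b (fun _ => 0)) as [c [_ H]].
- intros x. rewrite Rmin_left, Rmax_right by lra. apply Hd.
- intros x. rewrite Rmin_left, Rmax_right by lra. intros Hx.
  apply continuity_pt_filterlim, Hc, Hx.
- lra.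
Qed.

(** Carries an identity known inside an interval to its left endpoint. *)
Lemma continuous_zero_right (f : R -> R) (a b : R) : a < b -> continuous f a ->
  (forall x, a < x < b -> f x = 0) -> f a = 0.
Proof.
intros Hab Hc H. destruct (Req_dec (f a) 0) as [|Hn]; [assumption|exfalso].
assert (He := Rabs_pos_lt _ Hn).
destruct (proj1 (filterlim_locally _ _) Hc (mkposreal _ He)) as [d Hd].
set (r := Rmin d (b - a)).
assert (Hr : 0 < r) by (apply Rmin_pos; [apply cond_pos|lra]).
assert (r <= d) by apply Rmin_l. assert (r <= b - a) by apply Rmin_r.
specialize (Hd (a + r / 2)).
unfold ball in Hd; simpl in Hd; unfold AbsRing_ball, abs, minus, plus, opp in Hd; simpl in Hd.
rewrite (H (a + r / 2)), Rplus_0_l, Rabs_Ropp in Hd by lra.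
apply (Rlt_irrefl (Rabs (f a))), Hd.
replace (a + r / 2 + - a) with (r / 2) by ring. rewrite Rabs_pos_eq; lra.
Qed.

(** * Cosine and sine series with inverse powers *)

Definition cos_series (p : nat) (t : R) : R :=
  Series (fun m => cos (INR (S m) * t) / INR (S m) ^ p).

Definition sin_series (p : nat) (t : R) : R :=
  Series (fun m => sin (INR (S m) * t) / INR (S m) ^ p).

Lemma Rabs_div_pow_le (c : R) (p m : nat) : Rabs c <= 1 ->
  Rabs (c / INR (S m) ^ (p + 2)) <= / INR (S m) ^ 2.
Proof.
intros Hc. assert (Hk := INR_S_ge_1 m).
assert (0 < INR (S m) ^ (p + 2)) by (apply pow_lt; lra).
unfold Rdiv. rewrite Rabs_mult, Rabs_inv, (Rabs_pos_eq (_ ^ _)) by lra.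
apply Rle_trans with (2 := inv_pow_le_inv_sq m p).
assert (0 < / INR (S m) ^ (p + 2)) by now apply Rinv_0_lt_compat. nra.
Qed.

Lemma ex_series_bounded_div_pow (c : nat -> R) (p : nat) :
  (forall m, Rabs (c m) <= 1) -> ex_series (fun m => c m / INR (S m) ^ (p + 2)).
Proof.
intros H. apply ex_series_le_Rabs with (2 := ex_series_inv_sq).
intros m. now apply Rabs_div_pow_le.
Qed.

Lemma ex_cos_series (p : nat) (t : R) :
  ex_series (fun m => cos (INR (S m) * t) / INR (S m) ^ (p + 2)).
Proof.
apply (ex_series_bounded_div_pow (fun m => cos (INR (S m) * t))).
intros; apply Rabs_cos_le.
Qed.

Lemma ex_sin_series (p : nat) (t : R) :
  ex_series (fun m => sin (INR (S m) * t) / INR (S m) ^ (p + 2)).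
Proof.
apply (ex_series_bounded_div_pow (fun m => sin (INR (S m) * t))).
intros; apply Rabs_sin_le.
Qed.

(** The exponent is written [S (p + 2)] so that the differentiated series, of exponent [p + 2], is
    still dominated by the inverse squares. *)
Lemma is_derive_cos_series (p : nat) (t : R) :
  is_derive (cos_series (S (p + 2))) t (- sin_series (p + 2) t).
Proof.
unfold cos_series, sin_series. rewrite <- Series_opp.
apply (is_derive_Series (fun m s => cos (INR (S m) * s) / INR (S m) ^ S (p + 2))
  (fun m s => - (sin (INR (S m) * s) / INR (S m) ^ (p + 2)))
  (fun m => / INR (S m) ^ 2) t 1 Rlt_0_1).
- intros m s _. generalize (INR_S_ge_1 m). generalize (INR (S m)). intros k Hk.
  assert (0 < k ^ (p + 2)) by (apply pow_lt; lra).
  change (k ^ S (p + 2)) with (k * k ^ (p + 2)). generalize dependent (k ^ (p + 2)). intros q Hq.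
  auto_derive; [trivial|]. field. lra.
- intros m s _. rewrite Rabs_Ropp. apply Rabs_div_pow_le, Rabs_sin_le.
- apply ex_series_inv_sq.
- intros s _. apply (ex_cos_series (S p)).
Qed.

Lemma is_derive_sin_series (p : nat) (t : R) :
  is_derive (sin_series (S (p + 2))) t (cos_series (p + 2) t).
Proof.
unfold cos_series, sin_series.
apply (is_derive_Series (fun m s => sin (INR (S m) * s) / INR (S m) ^ S (p + 2))
  (fun m s => cos (INR (S m) * s) / INR (S m) ^ (p + 2))
  (fun m => / INR (S m) ^ 2) t 1 Rlt_0_1).
- intros m s _. generalize (INR_S_ge_1 m). generalize (INR (S m)). intros k Hk.
  assert (0 < k ^ (p + 2)) by (apply pow_lt; lra).
  change (k ^ S (p + 2)) with (k * k ^ (p + 2)). generalize dependent (k ^ (p + 2)). intros q Hq.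
  auto_derive; [trivial|]. field. lra.
- intros m s _. apply Rabs_div_pow_le, Rabs_cos_le.
- apply ex_series_inv_sq.
- intros s _. apply (ex_sin_series (S p)).
Qed.

Lemma continuous_cos_series (t : R) : continuous (cos_series 2) t.
Proof.
apply (continuous_Series (fun m s => cos (INR (S m) * s) / INR (S m) ^ 2)
  (fun m => / INR (S m) ^ 2) t 1 Rlt_0_1).
- intros m. generalize (INR_S_ge_1 m). generalize (INR (S m)). intros k Hk.
  apply (ex_derive_continuous (fun s => cos (k * s) / k ^ 2)). auto_derive. trivial.
- intros m s _. apply (Rabs_div_pow_le _ 0), Rabs_cos_le.
- apply ex_series_inv_sq.
Qed.

Lemma sin_series_0 (p : nat) : sin_series p 0 = 0.
Proof.
unfold sin_series. rewrite (Series_ext _ (fun _ => 0 * 0)).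
- rewrite Series_scal_l. ring.
- intros m. rewrite Rmult_0_r, sin_0. unfold Rdiv. ring.
Qed.

Lemma sin_series_2PI (p : nat) : sin_series p (2 * PI) = 0.
Proof.
rewrite <- (sin_series_0 p). apply Series_ext. intros m.
now rewrite sin_INR_2PI, Rmult_0_r, sin_0.
Qed.

Lemma cos_series_2PI (p : nat) : cos_series p (2 * PI) = cos_series p 0.
Proof.
apply Series_ext. intros m. now rewrite cos_INR_2PI, Rmult_0_r, cos_0.
Qed.

(** The termwise derivative is the sawtooth series, which has no summable majorant. The mean value
    theorem is applied to the partial sums instead: between [PI] and [t] the derivative of [P N]
    tends to [0] uniformly. The integration constant is settled afterwards. *)
Lemma cos_series_2_interior (t : R) : 0 < t < 2 * PI ->
  cos_series 2 t = t ^ 2 / 4 - PI * t / 2 + (cos_series 2 PI + PI ^ 2 / 4).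
Proof.
intros Ht.
set (P := fun N s => sum_n (fun m => cos (INR (S m) * s) / INR (S m) ^ 2) N
                     - (s ^ 2 / 4 - PI * s / 2)).
assert (Hd : forall N s, is_derive (P N) s (- sin_sum_defect N s)).
{ intros N s. unfold sin_sum_defect.
  replace (- (sum_n (fun m : nat => sin (INR (S m) * s) / INR (S m)) N - (PI - s) / 2))
    with (- sum_n (fun m : nat => sin (INR (S m) * s) / INR (S m)) N - (s / 2 - PI / 2)) by field.
  apply (is_derive_minus (V := R_NormedModule)).
  - replace (- sum_n (fun m : nat => sin (INR (S m) * s) / INR (S m)) N)
     with (sum_n (fun m : nat => - 1 * (sin (INR (S m) * s) / INR (S m))) N)
     by (etransitivity; [exact (sum_n_mult_l (K := R_AbsRing) (-1) _ N)|];
         exact (eq_trans (Ropp_mult_distr_l_reverse 1 _) (f_equal Ropp (Rmult_1_l _)))).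
    apply (is_derive_sum_n (V := R_NormedModule)
      (fun m s => cos (INR (S m) * s) / INR (S m) ^ 2)).
    intros m _. generalize (INR_S_ge_1 m). generalize (INR (S m)). intros k Hk.
    auto_derive; [trivial|]. field. lra.
  - auto_derive; [trivial|]. field. }
assert (Hlim : forall s, is_lim_seq (fun N => P N s) (cos_series 2 s - (s ^ 2 / 4 - PI * s / 2))).
{ intros s. apply is_lim_seq_minus'; [|apply is_lim_seq_const].
  apply is_series_Reals_lim, Series_correct, (ex_cos_series 0). }
assert (H0 : is_lim_seq (fun N => P N t - P N PI) 0).
{ apply is_lim_seq_Rabs_0
   with (2 := is_lim_seq_div_affine (PI * ((1 + PI) / sin (t / 2) ^ 2))).
  intros N. assert (HN := pos_INR N). assert (Hs := sin_half_pos t Ht).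
  destruct (MVT_gen (P N) PI t (fun s => - sin_sum_defect N s)) as [c [Hc1 Hc2]].
  - intros s _. apply Hd.
  - intros s _. apply continuity_pt_filterlim, (ex_derive_continuous (P N)). eexists. apply Hd.
  - rewrite Hc2, Rabs_mult, Rabs_Ropp.
    assert (Hc : 0 < c < 2 * PI).
    { revert Hc1. unfold Rmin, Rmax; destruct (Rle_dec PI t); generalize PI_RGT_0; lra. }
    assert (Hpi : Rabs (t - PI) <= PI) by (apply Rabs_le; lra).
    assert (Hsc := sin_half_ge c t Ht (between_PI c t Hc1)).
    assert (Hb := sin_sum_defect_bound N c Hc).
    assert (Hle : (1 + PI) / sin (c / 2) ^ 2 / (INR N + 3 / 2)
             <= (1 + PI) / sin (t / 2) ^ 2 / (INR N + 3 / 2)).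
    { generalize PI_RGT_0; intros. apply Rmult_le_compat_r.
      left; apply Rinv_0_lt_compat; lra.
      apply Rmult_le_compat_l; [lra|]. apply Rinv_le_contravar; [apply pow_lt; lra|].
      apply pow_incr; lra. }
    replace (PI * ((1 + PI) / sin (t / 2) ^ 2) / (INR N + 3 / 2))
      with ((1 + PI) / sin (t / 2) ^ 2 / (INR N + 3 / 2) * PI) by (field; lra).
    apply Rmult_le_compat; try apply Rabs_pos; lra. }
assert (E := is_lim_seq_unique _ _ H0).
assert (H1 := is_lim_seq_minus' _ _ _ _ (Hlim t) (Hlim PI)). cbv beta in H1.
assert (E' := is_lim_seq_unique _ _ H1). rewrite E in E'. injection E'. intros E2. lra.
Qed.

(** Meant for a trigonometric series [f], whose derivative is known everywhere, and a polynomial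
    [g], which matches it over one period only. *)
Lemma eq_on_period (f g f' : R -> R) (t : R) :
  (forall s, is_derive f s (f' s)) ->
  (forall s, 0 < s < 2 * PI -> is_derive g s (f' s)) ->
  (forall s, continuous g s) -> f 0 = g 0 ->
  0 <= t <= 2 * PI -> f t = g t.
Proof.
intros Hf Hg Hcg H0 Ht.
assert (E : f t - g t = f 0 - g 0).
{ apply (eq_of_zero_derive (fun s => f s - g s)); [lra| |].
  - intros s Hs. replace 0 with (f' s - f' s) by ring.
    apply (is_derive_minus (V := R_NormedModule)); [apply Hf|apply Hg; lra].
  - intros s _. apply (continuous_minus (V := R_NormedModule)); [|apply Hcg].
    apply (ex_derive_continuous f). exists (f' s). apply Hf. }
lra.
Qed.

(** The antiderivative [sin_series 3] vanishes at both ends of the period, so [cos_series 2] has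
    mean zero; this fixes the constant and solves the Basel problem. *)
Lemma cos_series_2_const : cos_series 2 PI + PI ^ 2 / 4 = PI ^ 2 / 6.
Proof.
assert (Hpi := PI_RGT_0).
set (c := cos_series 2 PI + PI ^ 2 / 4).
assert (E : sin_series 3 (2 * PI)
    = (fun t => t ^ 3 / 12 - PI * t ^ 2 / 4 + c * t) (2 * PI)).
{ apply (eq_on_period (sin_series 3)
    (fun t => t ^ 3 / 12 - PI * t ^ 2 / 4 + c * t) (cos_series 2)).
  - intros s. apply (is_derive_sin_series 0).
  - intros s Hs. rewrite cos_series_2_interior by exact Hs. fold c.
    auto_derive; [trivial|]. field.
  - intros s. apply (ex_derive_continuous (fun t => t ^ 3 / 12 - PI * t ^ 2 / 4 + c * t)).
    auto_derive. trivial.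
  - rewrite sin_series_0. field.
  - lra. }
rewrite sin_series_2PI in E. apply Rmult_eq_reg_l with (2 * PI); [|lra]. nra.
Qed.

(** The endpoint [0] is reached by continuity, and [2 * PI] by periodicity. *)
Lemma cos_series_2 (t : R) : 0 <= t <= 2 * PI ->
  cos_series 2 t = t ^ 2 / 4 - PI * t / 2 + PI ^ 2 / 6.
Proof.
intros Ht. assert (Hpi := PI_RGT_0).
assert (H0 : cos_series 2 0 = PI ^ 2 / 6).
{ apply Rminus_diag_uniq.
  replace (PI ^ 2 / 6) with (0 ^ 2 / 4 - PI * 0 / 2 + PI ^ 2 / 6) by field.
  apply (continuous_zero_right (fun t => cos_series 2 t - (t ^ 2 / 4 - PI * t / 2 + PI ^ 2 / 6))
     0 (2 * PI)); [lra| |].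
  - apply (continuous_minus (V := R_NormedModule)); [apply continuous_cos_series|].
    apply (ex_derive_continuous (fun t => t ^ 2 / 4 - PI * t / 2 + PI ^ 2 / 6)).
    auto_derive. trivial.
  - intros s Hs. rewrite cos_series_2_interior, cos_series_2_const by exact Hs. ring. }
destruct (Req_dec t 0) as [->|Hn0]; [rewrite H0; field|].
destruct (Req_dec t (2 * PI)) as [->|Hn1]; [rewrite cos_series_2PI, H0; field|].
rewrite cos_series_2_interior, cos_series_2_const by lra. ring.
Qed.

Lemma sin_series_3 (t : R) : 0 <= t <= 2 * PI ->
  sin_series 3 t = t ^ 3 / 12 - PI * t ^ 2 / 4 + PI ^ 2 * t / 6.
Proof.
apply (eq_on_period (sin_series 3) (fun t => t ^ 3 / 12 - PI * t ^ 2 / 4 + PI ^ 2 * t / 6)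
  (cos_series 2)).
- intros s. apply (is_derive_sin_series 0).
- intros s Hs. rewrite cos_series_2 by lra. auto_derive; [trivial|]. field.
- intros s. apply (ex_derive_continuous (fun t => t ^ 3 / 12 - PI * t ^ 2 / 4 + PI ^ 2 * t / 6)).
  auto_derive. trivial.
- rewrite sin_series_0. field.
Qed.

Lemma cos_series_4_const (t : R) : 0 <= t <= 2 * PI ->
  cos_series 4 t = - t ^ 4 / 48 + PI * t ^ 3 / 12 - PI ^ 2 * t ^ 2 / 12 + cos_series 4 0.
Proof.
set (c := cos_series 4 0).
apply (eq_on_period (cos_series 4)
  (fun t => - t ^ 4 / 48 + PI * t ^ 3 / 12 - PI ^ 2 * t ^ 2 / 12 + c)
  (fun s => - sin_series 3 s)).
- intros s. apply (is_derive_cos_series 1).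
- intros s Hs. rewrite sin_series_3 by lra. auto_derive; [trivial|]. field.
- intros s. apply (ex_derive_continuous
    (fun t => - t ^ 4 / 48 + PI * t ^ 3 / 12 - PI ^ 2 * t ^ 2 / 12 + c)).
  auto_derive. trivial.
- unfold c. field.
Qed.

(** The mean-zero argument again, now with the antiderivative [sin_series 5]. *)
Lemma cos_series_4_0 : cos_series 4 0 = PI ^ 4 / 90.
Proof.
assert (Hpi := PI_RGT_0).
set (c := cos_series 4 0).
assert (E : sin_series 5 (2 * PI)
    = (fun t => - t ^ 5 / 240 + PI * t ^ 4 / 48 - PI ^ 2 * t ^ 3 / 36 + c * t) (2 * PI)).
{ apply (eq_on_period (sin_series 5)
    (fun t => - t ^ 5 / 240 + PI * t ^ 4 / 48 - PI ^ 2 * t ^ 3 / 36 + c * t) (cos_series 4)).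
  - intros s. apply (is_derive_sin_series 2).
  - intros s Hs. rewrite cos_series_4_const by lra. fold c.
    auto_derive; [trivial|]. field.
  - intros s. apply (ex_derive_continuous
      (fun t => - t ^ 5 / 240 + PI * t ^ 4 / 48 - PI ^ 2 * t ^ 3 / 36 + c * t)).
    auto_derive. trivial.
  - rewrite sin_series_0. field.
  - lra. }
rewrite sin_series_2PI in E. apply Rmult_eq_reg_l with (2 * PI); [|lra]. lra.
Qed.

(** * Values of zeta, and even combinations of the Bernoulli series *)

Lemma zeta_cos_series (p : nat) : zeta (INR p) = cos_series p 0.
Proof.
apply Series_ext. intros m.
rewrite Rpower_Ropp, Rpower_pow by apply lt_0_INR, Nat.lt_0_succ.
rewrite Rmult_0_r, cos_0. unfold Rdiv. ring.
Qed.

Lemma zeta_2 : zeta 2 = PI ^ 2 / 6.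
Proof.
replace 2 with (INR 2) at 1 by (simpl; ring). rewrite zeta_cos_series, cos_series_2; [field|].
generalize PI_RGT_0; lra.
Qed.

Lemma zeta_4 : zeta 4 = PI ^ 4 / 90.
Proof.
replace 4 with (INR 4) at 1 by (simpl; ring). rewrite zeta_cos_series. apply cos_series_4_0.
Qed.

Lemma even_property (P : R -> Prop) (a : R) :
  (forall t, P (- t) -> P t) -> (forall t, 0 <= t < a -> P t) ->
  forall t, Rabs t < a -> P t.
Proof.
intros Hev Hpos t Ht. apply Rabs_def2 in Ht.
destruct (Rle_dec 0 t); [apply Hpos; lra|apply Hev, Hpos; lra].
Qed.

(** The terms in [PI * t] cancel in this combination, so the sum is an even polynomial and the
    formula holds for both signs of [t]. It is the conditionally convergent part to be split off
    from [residue_term]. *)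
Lemma is_series_cos2_sin1 (t : R) : Rabs t < 2 * PI ->
  is_series (fun m => cos (INR (S m) * t) / INR (S m) ^ 2
                      + t * (sin (INR (S m) * t) / INR (S m))) (PI ^ 2 / 6 - t ^ 2 / 4).
Proof.
revert t. apply even_property.
- intros t H. replace (t ^ 2) with ((- t) ^ 2) by ring.
  apply is_series_ext_R with (2 := H). intros m.
  replace (INR (S m) * - t) with (- (INR (S m) * t)) by ring.
  rewrite cos_neg, sin_neg. unfold Rdiv. ring.
- intros t Ht. assert (Hpi := PI_RGT_0).
  assert (H1 : is_series (fun m => cos (INR (S m) * t) / INR (S m) ^ 2)
            (t ^ 2 / 4 - PI * t / 2 + PI ^ 2 / 6)).
  { rewrite <- cos_series_2 by lra. apply Series_correct, (ex_cos_series 0). }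
  assert (H2 : is_series (fun m => t * (sin (INR (S m) * t) / INR (S m))) (t * ((PI - t) / 2))).
  (* The sawtooth formula fails at [t = 0], but the factor [t] kills both sides; the series at [PI]
     serves as an arbitrary convergent one to be multiplied by [0]. *)
  { destruct (Req_dec t 0) as [->|Hn].
    - apply is_series_ext_R with (fun m => 0 * (sin (INR (S m) * PI) / INR (S m))).
      intros m; now rewrite !Rmult_0_l. replace (0 * ((PI - 0) / 2)) with (0 * ((PI - PI) / 2)) by ring.
      apply is_series_scal_R, is_series_sin_div. lra.
    - apply is_series_scal_R, is_series_sin_div. lra. }
  replace (PI ^ 2 / 6 - t ^ 2 / 4)
    with ((t ^ 2 / 4 - PI * t / 2 + PI ^ 2 / 6) + t * ((PI - t) / 2)) by field.
  exact (is_series_plus_R _ _ _ _ H1 H2).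
Qed.

(** The coefficient [3] is the one that cancels the cubic terms in [t], again leaving an even
    polynomial. *)
Lemma is_series_cos4_sin3 (t : R) : Rabs t < 2 * PI ->
  is_series (fun m => 3 * (cos (INR (S m) * t) / INR (S m) ^ 4)
                      + t * (sin (INR (S m) * t) / INR (S m) ^ 3))
            (PI ^ 4 / 30 - PI ^ 2 * t ^ 2 / 12 + t ^ 4 / 48).
Proof.
revert t. apply even_property.
- intros t H. replace (t ^ 2) with ((- t) ^ 2) by ring. replace (t ^ 4) with ((- t) ^ 4) by ring.
  apply is_series_ext_R with (2 := H). intros m.
  replace (INR (S m) * - t) with (- (INR (S m) * t)) by ring.
  rewrite cos_neg, sin_neg. unfold Rdiv. ring.
- intros t Ht. assert (Hpi := PI_RGT_0).
  replace (PI ^ 4 / 30 - PI ^ 2 * t ^ 2 / 12 + t ^ 4 / 48)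
    with (3 * cos_series 4 t + t * sin_series 3 t)
    by (rewrite cos_series_4_const, cos_series_4_0, sin_series_3 by lra; field).
  apply is_series_plus_R.
  + apply is_series_scal_R, Series_correct, (ex_cos_series 2).
  + apply is_series_scal_R, Series_correct, (ex_sin_series 1).
Qed.

(** * The partial fraction expansion *)

Lemma cosh_sqr (a : R) : cosh a ^ 2 = 1 + sinh a ^ 2.
Proof.
unfold cosh, sinh. assert (H : exp a * exp (- a) = 1).
{ rewrite <- exp_plus, Rplus_opp_r. apply exp_0. }
nra.
Qed.

Lemma cosh_double (a : R) : cosh (2 * a) = 1 + 2 * sinh a ^ 2.
Proof.
unfold cosh, sinh. assert (H : exp a * exp (- a) = 1).
{ rewrite <- exp_plus, Rplus_opp_r. apply exp_0. }
replace (2 * a) with (a + a) by ring. replace (- (a + a)) with (- a + - a) by ring.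
rewrite !exp_plus. nra.
Qed.

Lemma sinh_double (a : R) : sinh (2 * a) = 2 * sinh a * cosh a.
Proof.
unfold cosh, sinh.
replace (2 * a) with (a + a) by ring. replace (- (a + a)) with (- a + - a) by ring.
rewrite !exp_plus. field.
Qed.

Lemma cosh_pos (a : R) : 0 < cosh a.
Proof. unfold cosh. generalize (exp_pos a) (exp_pos (- a)). lra. Qed.

Lemma sinh_pos (a : R) : 0 < a -> 0 < sinh a.
Proof. intros H. rewrite <- sinh_0. now apply sinh_lt. Qed.

(** The first integrals [(y' + e x y) exp (- e x t)] with [e = 1] and [e = -1] are constant, which
    forces [y t = y 0 * cosh (x * t)]. Such a function takes equal values at [0] and [T] only if
    [y 0 = 0]. *)
Lemma periodic_ode_zero (y y1 : R -> R) (x T : R) : 0 < x -> 0 < T ->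
  (forall t, 0 < t < T -> is_derive y t (y1 t)) ->
  (forall t, 0 < t < T -> is_derive y1 t (x ^ 2 * y t)) ->
  (forall t, continuous y t) -> (forall t, continuous y1 t) ->
  y1 0 = 0 -> y T = y 0 ->
  forall t, 0 <= t <= T -> y t = 0 /\ y1 t = 0.
Proof.
intros Hx HT Hy Hy1 Cy Cy1 H0 HyT.
assert (F : forall e t, e ^ 2 = 1 -> 0 <= t <= T ->
   (y1 t + e * x * y t) * exp (- (e * x * t)) = e * x * y 0).
{ intros e t He Ht.
  replace (e * x * y 0) with ((y1 0 + e * x * y 0) * exp (- (e * x * 0)))
    by (rewrite H0, Rmult_0_r, Ropp_0, exp_0; ring).
  apply (eq_of_zero_derive (fun s => (y1 s + e * x * y s) * exp (- (e * x * s)))); [lra| |].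
  - intros s Hs.
    assert (D1 := Hy s ltac:(lra)). assert (D2 := Hy1 s ltac:(lra)).
    evar_last.
    + apply (is_derive_mult (fun s => y1 s + e * x * y s) (fun s => exp (- (e * x * s))) s
        (x ^ 2 * y s + e * x * y1 s) (- (e * x) * exp (- (e * x * s)))).
      * apply (is_derive_plus (V := R_NormedModule)); [exact D2|].
        apply (is_derive_scal y s (e * x) (y1 s)), D1.
      * auto_derive; [trivial|]. ring.
      * intros; apply Rmult_comm.
    + unfold plus, mult; simpl.
      transitivity ((1 - e * (e * 1)) * x ^ 2 * y s * exp (- (e * x * s))); [ring|].
      simpl in He. rewrite He. ring.
  - intros s _. apply (continuous_mult (K := R_AbsRing)).
    + apply (continuous_plus (V := R_NormedModule)); [apply Cy1|].
      apply (continuous_scal_r (V := R_NormedModule) (e * x) y), Cy.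
    + apply (ex_derive_continuous (fun s => exp (- (e * x * s)))). auto_derive. trivial. }
assert (G : forall t, 0 <= t <= T -> y1 t = x * y 0 * sinh (x * t) /\ y t = y 0 * cosh (x * t)).
{ intros t Ht.
  assert (Fp := F 1 t ltac:(ring) Ht). assert (Fm := F (-1) t ltac:(ring) Ht).
  replace (- (1 * x * t)) with (- (x * t)) in Fp by ring.
  replace (- (-1 * x * t)) with (x * t) in Fm by ring.
  assert (He : exp (x * t) * exp (- (x * t)) = 1).
  { rewrite <- exp_plus, Rplus_opp_r. apply exp_0. }
  assert (Ep : y1 t + x * y t = x * y 0 * exp (x * t)).
  { transitivity ((y1 t + 1 * x * y t) * exp (- (x * t)) * exp (x * t)).
    - replace (y1 t + x * y t) with ((y1 t + 1 * x * y t) * (exp (x * t) * exp (- (x * t))))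
       by (rewrite He; ring). ring.
    - rewrite Fp. ring. }
  assert (Em : y1 t - x * y t = - x * y 0 * exp (- (x * t))).
  { transitivity ((y1 t + -1 * x * y t) * exp (x * t) * exp (- (x * t))).
    - replace (y1 t - x * y t) with ((y1 t + -1 * x * y t) * (exp (x * t) * exp (- (x * t))))
       by (rewrite He; ring). ring.
    - rewrite Fm. ring. }
  unfold cosh, sinh. split; [lra|].
  apply Rmult_eq_reg_l with x; lra. }
assert (Hz : y 0 = 0).
(* [cosh (x T) - 1] equals [2 sinh (x T / 2) ^ 2], which is not zero. *)
{ destruct (G T ltac:(lra)) as [_ GT]. rewrite HyT in GT.
  assert (Hs := sinh_pos (x * T / 2) ltac:(nra)).
  assert (Hc := cosh_double (x * T / 2)).
  replace (2 * (x * T / 2)) with (x * T) in Hc by field. rewrite Hc in GT.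
  apply Rmult_eq_reg_r with (sinh (x * T / 2) ^ 2); [lra|]. apply pow_nonzero. lra. }
intros t Ht. destruct (G t Ht) as [G1 G2]. rewrite G1, G2, Hz. split; ring.
Qed.

(** For [x] nonzero this is [residue_term x k t + 2 (cos (k t) / k ^ 2 + t sin (k t) / k)] divided
    by [x ^ 2], of order [1 / k ^ 3]. Each summand is laid out as coefficient, trigonometric factor
    and nonnegative weight, the shape that [lin_bound] estimates. *)
Definition kernel_term (x k t : R) : R :=
  2 * (cos (k * t) * (/ (k ^ 2 * (x ^ 2 + k ^ 2)) + 2 * / (x ^ 2 + k ^ 2) ^ 2))
  + 2 * t * (sin (k * t) * / (k * (x ^ 2 + k ^ 2))).

Definition kernel_term1 (x k t : R) : R :=
  -4 * (sin (k * t) * (k * / (x ^ 2 + k ^ 2) ^ 2)) + 2 * t * (cos (k * t) * / (x ^ 2 + k ^ 2)).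

(* [kernel_term1] without its slowly decaying part [2 t cos (k t) / k ^ 2]. *)
Definition remainder_term (x k t : R) : R :=
  -4 * (sin (k * t) * (k * / (x ^ 2 + k ^ 2) ^ 2))
  + - (2 * x ^ 2 * t) * (cos (k * t) * / (k ^ 2 * (x ^ 2 + k ^ 2))).

Definition remainder_term1 (x k t : R) : R :=
  -4 * (cos (k * t) * (k ^ 2 * / (x ^ 2 + k ^ 2) ^ 2))
  + - (2 * x ^ 2) * (cos (k * t) * / (k ^ 2 * (x ^ 2 + k ^ 2)))
  + 2 * x ^ 2 * t * (sin (k * t) * / (k * (x ^ 2 + k ^ 2))).

Lemma lin_bound (a c w W : R) : Rabs c <= 1 -> 0 <= w <= W -> Rabs (a * (c * w)) <= Rabs a * W.
Proof.
intros Hc Hw. rewrite !Rabs_mult, (Rabs_pos_eq w) by lra.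
apply Rmult_le_compat_l; [apply Rabs_pos|].
generalize (Rabs_pos c). nra.
Qed.

Lemma inv_le_div_sq (A D : R) (k : R) : 0 <= A -> 0 < D -> 1 <= k -> A * k ^ 2 <= D ->
  0 <= A * / D <= / k ^ 2.
Proof.
intros HA HD Hk H. split.
- apply Rmult_le_pos; [exact HA|]. left. now apply Rinv_0_lt_compat.
- assert (0 < k ^ 2) by (apply pow_lt; lra).
  apply Rmult_le_reg_r with (D * k ^ 2); [now apply Rmult_lt_0_compat|].
  replace (A * / D * (D * k ^ 2)) with (A * k ^ 2) by (field; lra).
  replace (/ k ^ 2 * (D * k ^ 2)) with D by (field; lra). exact H.
Qed.

(** * Inverse-square bounds and derivatives of the summands *)

Section Weights.
Context (x k : R) (Hk : 1 <= k).

Let HD : k ^ 2 <= x ^ 2 + k ^ 2.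
Proof. nra. Qed.

Let Hk2 : 1 <= k ^ 2.
Proof. nra. Qed.

Lemma inv_sq_mul_le : 0 <= / (k ^ 2 * (x ^ 2 + k ^ 2)) <= / k ^ 2.
Proof.
rewrite <- (Rmult_1_l (/ (k ^ 2 * _))). apply inv_le_div_sq; nra.
Qed.

Lemma inv_sqsum_sq_le : 0 <= / (x ^ 2 + k ^ 2) ^ 2 <= / k ^ 2.
Proof.
rewrite <- (Rmult_1_l (/ (_ ^ 2))). apply inv_le_div_sq; nra.
Qed.

Lemma inv_mul_le : 0 <= / (k * (x ^ 2 + k ^ 2)) <= / k ^ 2.
Proof.
rewrite <- (Rmult_1_l (/ (k * _))). apply inv_le_div_sq; nra.
Qed.

Lemma div_sqsum_sq_le : 0 <= k * / (x ^ 2 + k ^ 2) ^ 2 <= / k ^ 2.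
Proof.
assert (k * k ^ 2 <= k ^ 2 * k ^ 2) by nra.
assert (k ^ 2 * k ^ 2 <= (x ^ 2 + k ^ 2) ^ 2) by nra.
apply inv_le_div_sq; nra.
Qed.

Lemma inv_sqsum_le : 0 <= / (x ^ 2 + k ^ 2) <= / k ^ 2.
Proof.
rewrite <- (Rmult_1_l (/ (x ^ 2 + _))). apply inv_le_div_sq; nra.
Qed.

Lemma sq_div_sqsum_sq_le : 0 <= k ^ 2 * / (x ^ 2 + k ^ 2) ^ 2 <= / k ^ 2.
Proof.
assert (k ^ 2 * k ^ 2 <= (x ^ 2 + k ^ 2) ^ 2) by nra.
apply inv_le_div_sq; nra.
Qed.

Lemma kernel_term_bound (t : R) : Rabs (kernel_term x k t) <= (6 + 2 * Rabs t) / k ^ 2.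
Proof.
unfold kernel_term. eapply Rle_trans; [apply Rabs_triang|].
assert (W1 := inv_sq_mul_le). assert (W2 := inv_sqsum_sq_le).
assert (W3 : 0 <= / (k ^ 2 * (x ^ 2 + k ^ 2)) + 2 * / (x ^ 2 + k ^ 2) ^ 2 <= 3 * / k ^ 2) by lra.
assert (B1 := lin_bound 2 _ _ _ (Rabs_cos_le (k * t)) W3).
assert (B2 := lin_bound (2 * t) _ _ _ (Rabs_sin_le (k * t)) inv_mul_le).
rewrite (Rabs_mult 2 t), (Rabs_pos_eq 2) in B2 by lra. rewrite (Rabs_pos_eq 2) in B1 by lra.
unfold Rdiv. lra.
Qed.

Lemma kernel_term1_bound (t : R) : Rabs (kernel_term1 x k t) <= (4 + 2 * Rabs t) / k ^ 2.
Proof.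
unfold kernel_term1. eapply Rle_trans; [apply Rabs_triang|].
assert (B1 := lin_bound (-4) _ _ _ (Rabs_sin_le (k * t)) div_sqsum_sq_le).
assert (B2 := lin_bound (2 * t) _ _ _ (Rabs_cos_le (k * t)) inv_sqsum_le).
rewrite (Rabs_mult 2 t), (Rabs_pos_eq 2) in B2 by lra.
replace (Rabs (-4)) with 4 in B1 by (rewrite Rabs_left; lra).
unfold Rdiv. lra.
Qed.

Lemma remainder_term_bound (t : R) : Rabs (remainder_term x k t) <= (4 + 2 * x ^ 2 * Rabs t) / k ^ 2.
Proof.
unfold remainder_term. eapply Rle_trans; [apply Rabs_triang|].
assert (B1 := lin_bound (-4) _ _ _ (Rabs_sin_le (k * t)) div_sqsum_sq_le).
assert (B2 := lin_bound (- (2 * x ^ 2 * t)) _ _ _ (Rabs_cos_le (k * t)) inv_sq_mul_le).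
rewrite Rabs_Ropp, (Rabs_mult (2 * x ^ 2) t), (Rabs_pos_eq (2 * x ^ 2)) in B2 by nra.
replace (Rabs (-4)) with 4 in B1 by (rewrite Rabs_left; lra).
unfold Rdiv. lra.
Qed.

Lemma remainder_term1_bound (t : R) :
  Rabs (remainder_term1 x k t) <= (4 + 2 * x ^ 2 + 2 * x ^ 2 * Rabs t) / k ^ 2.
Proof.
unfold remainder_term1. eapply Rle_trans; [apply Rabs_triang|].
eapply Rle_trans; [apply Rplus_le_compat_r, Rabs_triang|].
assert (B1 := lin_bound (-4) _ _ _ (Rabs_cos_le (k * t)) sq_div_sqsum_sq_le).
assert (B2 := lin_bound (- (2 * x ^ 2)) _ _ _ (Rabs_cos_le (k * t)) inv_sq_mul_le).
assert (B3 := lin_bound (2 * x ^ 2 * t) _ _ _ (Rabs_sin_le (k * t)) inv_mul_le).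
rewrite (Rabs_mult (2 * x ^ 2) t), (Rabs_pos_eq (2 * x ^ 2)) in B3 by nra.
rewrite Rabs_Ropp, (Rabs_pos_eq (2 * x ^ 2)) in B2 by nra.
replace (Rabs (-4)) with 4 in B1 by (rewrite Rabs_left; lra).
unfold Rdiv. lra.
Qed.

Lemma is_derive_kernel_term (t : R) : is_derive (kernel_term x k) t (kernel_term1 x k t).
Proof.
unfold kernel_term, kernel_term1. auto_derive; [trivial|]. field. split; nra.
Qed.

Lemma is_derive_remainder_term (t : R) : is_derive (remainder_term x k) t (remainder_term1 x k t).
Proof.
unfold remainder_term, remainder_term1. auto_derive; [trivial|]. field. split; nra.
Qed.

(** Differentiating the slow part termwise would produce [- 2 t sin (k t) / k], beyond the reach of
    dominated differentiation. It is summed in closed form through [cos_series 2] instead, and only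
    the remainder is differentiated under the sum. *)
Lemma kernel_term1_split (t : R) : kernel_term1 x k t = 2 * t * (cos (k * t) / k ^ 2) + remainder_term x k t.
Proof. unfold kernel_term1, remainder_term. field. split; nra. Qed.

(** The source of the differential equation: the kernel reappears with factor [x ^ 2], and the rest
    is an explicit Bernoulli series. *)
Lemma remainder_term1_split (t : R) : remainder_term1 x k t = x ^ 2 * kernel_term x k t - 4 * (cos (k * t) / k ^ 2).
Proof. unfold remainder_term1, kernel_term. field. split; nra. Qed.

End Weights.

(** * The kernel series over the integers and its closed form *)

Section ModeSeries.
Context (x : R).

Definition kernel_sum (t : R) : R := Series (fun m => kernel_term x (INR (S m)) t).
Definition kernel_sum1 (t : R) : R := Series (fun m => kernel_term1 x (INR (S m)) t).
Definition remainder_sum (t : R) : R := Series (fun m => remainder_term x (INR (S m)) t).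

Lemma ex_kernel_sum (t : R) : ex_series (fun m => kernel_term x (INR (S m)) t).
Proof.
apply ex_series_sq_bound with (6 + 2 * Rabs t). intros m. apply kernel_term_bound, INR_S_ge_1.
Qed.

Lemma ex_kernel_sum1 (t : R) : ex_series (fun m => kernel_term1 x (INR (S m)) t).
Proof.
apply ex_series_sq_bound with (4 + 2 * Rabs t). intros m. apply kernel_term1_bound, INR_S_ge_1.
Qed.

Lemma ex_remainder_sum (t : R) : ex_series (fun m => remainder_term x (INR (S m)) t).
Proof.
apply ex_series_sq_bound with (4 + 2 * x ^ 2 * Rabs t).
intros m. apply remainder_term_bound, INR_S_ge_1.
Qed.

Lemma Rabs_near (t s : R) : Rabs (s - t) < 1 -> Rabs s <= Rabs t + 1.
Proof.
intros H. replace s with (t + (s - t)) by ring.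
generalize (Rabs_triang t (s - t)). lra.
Qed.

Lemma div_sq_le (a b : R) (m : nat) : a <= b -> a / INR (S m) ^ 2 <= b / INR (S m) ^ 2.
Proof.
intros H. apply Rmult_le_compat_r; [|exact H].
left. apply Rinv_0_lt_compat, pow_lt. generalize (INR_S_ge_1 m). lra.
Qed.

Lemma is_derive_kernel_sum (t : R) : is_derive kernel_sum t (kernel_sum1 t).
Proof.
apply (is_derive_Series (fun m s => kernel_term x (INR (S m)) s) (fun m s => kernel_term1 x (INR (S m)) s)
  (fun m => (4 + 2 * (Rabs t + 1)) / INR (S m) ^ 2) t 1 Rlt_0_1).
- intros m s _. apply is_derive_kernel_term, INR_S_ge_1.
- intros m s Hs. eapply Rle_trans; [apply kernel_term1_bound, INR_S_ge_1|].
  apply div_sq_le. generalize (Rabs_near t s Hs). lra.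
- apply ex_series_scal_R, ex_series_inv_sq.
- intros s _. apply ex_kernel_sum.
Qed.

Lemma is_derive_remainder_sum (t : R) : is_derive remainder_sum t (x ^ 2 * kernel_sum t - 4 * cos_series 2 t).
Proof.
replace (x ^ 2 * kernel_sum t - 4 * cos_series 2 t) with (Series (fun m => remainder_term1 x (INR (S m)) t)).
- apply (is_derive_Series (fun m s => remainder_term x (INR (S m)) s) (fun m s => remainder_term1 x (INR (S m)) s)
    (fun m => (4 + 2 * x ^ 2 + 2 * x ^ 2 * (Rabs t + 1)) / INR (S m) ^ 2) t 1 Rlt_0_1).
  + intros m s _. apply is_derive_remainder_term, INR_S_ge_1.
  + intros m s Hs. eapply Rle_trans; [apply remainder_term1_bound, INR_S_ge_1|].
    apply div_sq_le. generalize (Rabs_near t s Hs). nra.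
  + apply ex_series_scal_R, ex_series_inv_sq.
  + intros s _. apply ex_remainder_sum.
- unfold kernel_sum, cos_series. rewrite <- !Series_scal_l, <- Series_minus.
  + apply Series_ext. intros m. apply remainder_term1_split, INR_S_ge_1.
  + apply ex_series_scal_R, ex_kernel_sum.
  + apply ex_series_scal_R, (ex_cos_series 0).
Qed.

Lemma kernel_sum1_split (t : R) : kernel_sum1 t = 2 * t * cos_series 2 t + remainder_sum t.
Proof.
unfold kernel_sum1, remainder_sum, cos_series. rewrite <- Series_scal_l, <- Series_plus.
- apply Series_ext. intros m. apply kernel_term1_split, INR_S_ge_1.
- apply ex_series_scal_R, (ex_cos_series 0).
- apply ex_remainder_sum.
Qed.

Lemma remainder_sum_0 : remainder_sum 0 = 0.
Proof.
unfold remainder_sum. rewrite (Series_ext _ (fun _ => 0 * 0)).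
- rewrite Series_scal_l. ring.
- intros m. unfold remainder_term. rewrite !Rmult_0_r, sin_0. ring.
Qed.

Lemma kernel_sum_2PI : kernel_sum (2 * PI) = kernel_sum 0.
Proof.
apply Series_ext. intros m. unfold kernel_term.
rewrite cos_INR_2PI, sin_INR_2PI, !Rmult_0_r, sin_0, cos_0. ring.
Qed.

Lemma is_derive_cosh_scal (a t : R) : is_derive (fun s => cosh (a * s)) t (a * sinh (a * t)).
Proof. unfold cosh, sinh. auto_derive; [trivial|]. field. Qed.

Lemma is_derive_sinh_scal (a t : R) : is_derive (fun s => sinh (a * s)) t (a * cosh (a * t)).
Proof. unfold cosh, sinh. auto_derive; [trivial|]. field. Qed.

Lemma kernel_sum_closed_form (Hx : 0 < x) (t : R) : 0 <= t <= 2 * PI ->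
  kernel_sum t = 2 * (PI ^ 2 / 6 - t ^ 2 / 4) / x ^ 2 - 1 / x ^ 4
        + PI ^ 2 / (x ^ 2 * sinh (PI * x) ^ 2) * cosh (x * t)
  /\ kernel_sum1 t = - t / x ^ 2 + PI ^ 2 / (x ^ 2 * sinh (PI * x) ^ 2) * (x * sinh (x * t)).
Proof.
intros Ht. assert (Hpi := PI_RGT_0).
assert (Hs : 0 < sinh (PI * x)) by (apply sinh_pos; nra).
set (al := PI ^ 2 / (x ^ 2 * sinh (PI * x) ^ 2)).
(* A polynomial particular solution plus [al] times an even homogeneous one, so [g1 0 = 0]; the
   value of [al] is dictated by [g (2 PI) = g 0]. *)
set (g := fun s => 2 * (PI ^ 2 / 6 - s ^ 2 / 4) / x ^ 2 - 1 / x ^ 4 + al * cosh (x * s)).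
set (g1 := fun s => - s / x ^ 2 + al * (x * sinh (x * s))).
(* [h] is [kernel_sum1] with [cos_series 2] replaced by its Bernoulli polynomial: the two agree on
   the period, and [h] is differentiable on the whole line. *)
set (h := fun s => 2 * s * (s ^ 2 / 4 - PI * s / 2 + PI ^ 2 / 6) + remainder_sum s).
assert (Dg : forall s, is_derive g s (g1 s)).
{ intros s. apply (is_derive_plus (V := R_NormedModule)).
  - auto_derive; [trivial|]. field. lra.
  - apply (is_derive_scal (fun s => cosh (x * s))), is_derive_cosh_scal. }
assert (Dg1 : forall s, is_derive g1 s (x ^ 2 * g s - 2 * (PI ^ 2 / 6 - s ^ 2 / 4))).
{ intros s. replace (x ^ 2 * g s - 2 * (PI ^ 2 / 6 - s ^ 2 / 4))
    with (- 1 / x ^ 2 + al * (x * (x * cosh (x * s)))) by (unfold g; field; lra).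
  apply (is_derive_plus (V := R_NormedModule)).
  - auto_derive; [trivial|]. field. lra.
  - apply (is_derive_scal (fun s => x * sinh (x * s))).
    apply (is_derive_scal (fun s => sinh (x * s))), is_derive_sinh_scal. }
assert (Dh : forall s, is_derive h s
   (2 * (s ^ 2 / 4 - PI * s / 2 + PI ^ 2 / 6) + 2 * s * (s / 2 - PI / 2)
    + (x ^ 2 * kernel_sum s - 4 * cos_series 2 s))).
{ intros s. apply (is_derive_plus (V := R_NormedModule)); [|apply is_derive_remainder_sum].
  auto_derive; [trivial|]. field. }
assert (EV1 : forall s, 0 <= s <= 2 * PI -> kernel_sum1 s = h s).
{ intros s Hs'. rewrite kernel_sum1_split, cos_series_2 by exact Hs'. reflexivity. }
assert (Hode := periodic_ode_zero (fun s => kernel_sum s - g s) (fun s => h s - g1 s) x (2 * PI) Hx ltac:(lra)).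
destruct Hode with t as [E1 E2].
- intros s Hs'. rewrite <- EV1 by lra.
  apply (is_derive_minus (V := R_NormedModule)); [apply is_derive_kernel_sum|apply Dg].
- intros s Hs'.
  replace (x ^ 2 * (kernel_sum s - g s)) with
   (2 * (s ^ 2 / 4 - PI * s / 2 + PI ^ 2 / 6) + 2 * s * (s / 2 - PI / 2)
    + (x ^ 2 * kernel_sum s - 4 * cos_series 2 s) - (x ^ 2 * g s - 2 * (PI ^ 2 / 6 - s ^ 2 / 4)))
   by (rewrite cos_series_2 by lra; field).
  apply (is_derive_minus (V := R_NormedModule)); [apply Dh|apply Dg1].
- intros s. apply (continuous_minus (V := R_NormedModule)).
  apply (ex_derive_continuous kernel_sum); eexists; apply is_derive_kernel_sum.
  apply (ex_derive_continuous g); eexists; apply Dg.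
- intros s. apply (continuous_minus (V := R_NormedModule)).
  apply (ex_derive_continuous h); eexists; apply Dh.
  apply (ex_derive_continuous g1); eexists; apply Dg1.
- unfold h, g1. rewrite remainder_sum_0, !Rmult_0_r, sinh_0. field. lra.
- rewrite kernel_sum_2PI. unfold g. replace (x * (2 * PI)) with (2 * (PI * x)) by ring.
  rewrite cosh_double, Rmult_0_r, cosh_0. unfold al. field. lra.
- exact Ht.
- rewrite EV1 by exact Ht. fold (g t) (g1 t). split; lra.
Qed.

(** At [t = 2 * PI] the sines vanish and the cosines are [1], so [kernel_term1] collapses to
    [4 PI / (x ^ 2 + k ^ 2)]. *)
Lemma is_series_inv_add_sq (Hx : 0 < x) :
  is_series (fun m => / (x ^ 2 + INR (S m) ^ 2))
    (PI * coth (PI * x) / (2 * x) - 1 / (2 * x ^ 2)).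
Proof.
assert (Hpi := PI_RGT_0).
assert (Hs : 0 < sinh (PI * x)) by (apply sinh_pos; nra).
destruct (kernel_sum_closed_form Hx (2 * PI) ltac:(lra)) as [_ E].
assert (H := Series_correct _ (ex_kernel_sum1 (2 * PI))). fold (kernel_sum1 (2 * PI)) in H. rewrite E in H.
apply (is_series_scal_R (/ (4 * PI))) in H.
replace (PI * coth (PI * x) / (2 * x) - 1 / (2 * x ^ 2)) with
 (/ (4 * PI) * (- (2 * PI) / x ^ 2 + PI ^ 2 / (x ^ 2 * sinh (PI * x) ^ 2) * (x * sinh (x * (2 * PI))))).
- apply is_series_ext_R with (2 := H). intros m. unfold kernel_term1.
  rewrite sin_INR_2PI, cos_INR_2PI. field. generalize (INR_S_ge_1 m). nra.
- replace (x * (2 * PI)) with (2 * (PI * x)) by ring. rewrite sinh_double. unfold coth. field. lra.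
Qed.

(** This is twice the derivative in [k] of [k cos (k t) / (x ^ 2 + k ^ 2)], the shape of a residue
    at a double pole. *)
Definition residue_term (k t : R) : R :=
  2 * cos (k * t) * (x ^ 2 - k ^ 2) / (x ^ 2 + k ^ 2) ^ 2
  - 2 * t * k * sin (k * t) / (x ^ 2 + k ^ 2).

Lemma residue_term_split (k t : R) : 1 <= k ->
  residue_term k t = x ^ 2 * kernel_term x k t - 2 * (cos (k * t) / k ^ 2 + t * (sin (k * t) / k)).
Proof. intros Hk. unfold residue_term, kernel_term. field. split; nra. Qed.

(** Subtracting the Bernoulli series from [x ^ 2] times the kernel series cancels the quadratic
    polynomial in [t]. *)
Lemma is_series_residue_term (Hx : 0 < x) (t : R) : Rabs t < 2 * PI ->
  is_series (fun m => residue_term (INR (S m)) t) (PI ^ 2 * cosh (x * t) / sinh (PI * x) ^ 2 - 1 / x ^ 2).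
Proof.
revert t. apply even_property.
- intros t H. replace (cosh (x * t)) with (cosh (x * - t)).
  + apply is_series_ext_R with (2 := H). intros m. unfold residue_term.
    replace (INR (S m) * - t) with (- (INR (S m) * t)) by ring.
    rewrite cos_neg, sin_neg. field. generalize (INR_S_ge_1 m). nra.
  + unfold cosh. replace (x * - t) with (- (x * t)) by ring. rewrite Ropp_involutive. field.
- intros t Ht. assert (Hpi := PI_RGT_0).
  assert (Hs : 0 < sinh (PI * x)) by (apply sinh_pos; nra).
  destruct (kernel_sum_closed_form Hx t ltac:(lra)) as [E _].
  assert (H := Series_correct _ (ex_kernel_sum t)). fold (kernel_sum t) in H. rewrite E in H.
  assert (He := is_series_cos2_sin1 t ltac:(apply Rabs_def1; lra)).
  assert (H' := is_series_minus_R _ _ _ _ (is_series_scal_R (x ^ 2) _ _ H) (is_series_scal_R 2 _ _ He)).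
  cbv beta in H'.
  replace (PI ^ 2 * cosh (x * t) / sinh (PI * x) ^ 2 - 1 / x ^ 2) with
   (x ^ 2 * (2 * (PI ^ 2 / 6 - t ^ 2 / 4) / x ^ 2 - 1 / x ^ 4
     + PI ^ 2 / (x ^ 2 * sinh (PI * x) ^ 2) * cosh (x * t)) - 2 * (PI ^ 2 / 6 - t ^ 2 / 4))
   by (field; lra).
  apply is_series_ext_R with (2 := H'). intros m. symmetry. apply residue_term_split, INR_S_ge_1.
Qed.

End ModeSeries.

(** * Half-integers and exchange of sums *)

(** The number [m + 1 / 2], spelled so that [(2 n - 1) / 2] at [n = S m] is convertible to it. *)
Definition half (m : nat) : R := (2 * INR (S m) - 1) / 2.

Lemma half_ge (m : nat) : INR (S m) <= 2 * half m.
Proof. unfold half. generalize (INR_S_ge_1 m). lra. Qed.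

Lemma half_pos (m : nat) : 0 < half m.
Proof. generalize (half_ge m) (INR_S_ge_1 m). lra. Qed.

(** Argued on partial sums because the convergence may be conditional: the first [N + 1] odd terms
    are the first [2 N + 2] terms without the even ones. *)
Lemma is_series_odd_part (F : R -> R) (l1 l2 : R) :
  is_series (fun m => F (INR (S m))) l1 -> is_series (fun m => F (2 * INR (S m))) l2 ->
  is_series (fun m => F (2 * half m)) (l1 - l2).
Proof.
intros H1 H2. apply is_series_Reals_lim.
apply is_lim_seq_ext with (fun N => sum_n (fun m => F (INR (S m))) (2 * N + 1)
   - sum_n (fun m => F (2 * INR (S m))) N).
- intros N. induction N as [|N IH].
  + simpl Nat.add. rewrite sum_Sn_R, !sum_O. unfold half.
    replace (2 * ((2 * INR 1 - 1) / 2)) with (INR 1) by (simpl; field).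
    replace (2 * INR 1) with (INR 2) by (simpl; ring). ring.
  + replace (2 * S N + 1)%nat with (S (S (2 * N + 1))) by lia.
    rewrite !sum_Sn_R, <- IH. unfold half.
    replace (2 * ((2 * INR (S (S N)) - 1) / 2)) with (INR (S (S (2 * N + 1))))
      by (rewrite !S_INR, plus_INR, mult_INR; simpl; field).
    replace (2 * INR (S (S N))) with (INR (S (S (S (2 * N + 1)))))
      by (rewrite !S_INR, plus_INR, mult_INR; simpl; ring). ring.
- apply is_lim_seq_minus'; [|exact H2].
  apply (is_lim_seq_subseq (sum_n (fun m => F (INR (S m)))) l1 (fun N => (2 * N + 1)%nat)).
  + apply eventually_subseq. intros N. lia.
  + exact H1.
Qed.

(* All lattice sums below are homogeneous: the even terms reproduce the full sum up to scaling. *)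
Lemma is_series_half (G F : R -> R) (l1 l2 : R) :
  (forall k, 0 < k -> F (2 * k) = G k) ->
  is_series (fun m => F (INR (S m))) l1 -> is_series (fun m => G (INR (S m))) l2 ->
  is_series (fun m => G (half m)) (l1 - l2).
Proof.
intros HFG H1 H2.
apply is_series_ext_R with (fun m => F (2 * half m)).
{ intros m. apply HFG, half_pos. }
apply is_series_odd_part; [exact H1|].
apply is_series_ext_R with (2 := H2). intros m. symmetry. apply HFG.
generalize (INR_S_ge_1 m). lra.
Qed.

Lemma sq_add_pos (x k : R) : 0 < k -> 0 < x ^ 2 + k ^ 2.
Proof. nra. Qed.

(** Doubling [x] and [k] while halving [t] divides [residue_term] by [4] and preserves [x * t]. In
    the difference the [1 / x ^ 2] terms cancel, and [1 - cosh ^ 2 = - sinh ^ 2] turns the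
    hyperbolic part into [- 1 / cosh ^ 2]. *)
Lemma is_series_half_residue_term (x t : R) : 0 < x -> Rabs t < 2 * PI ->
  is_series (fun m => residue_term x (half m) t) (- (PI ^ 2 * cosh (x * t) / cosh (PI * x) ^ 2)).
Proof.
intros Hx Ht. assert (Hpi := PI_RGT_0).
assert (Hs : 0 < sinh (PI * x)) by (apply sinh_pos; nra). assert (Hc := cosh_pos (PI * x)).
assert (Ht2 : Rabs (t / 2) < 2 * PI).
{ apply Rabs_def2 in Ht. apply Rabs_def1; lra. }
assert (H1 := is_series_scal_R 4 _ _ (is_series_residue_term (2 * x) ltac:(lra) (t / 2) Ht2)).
assert (H2 := is_series_residue_term x Hx t Ht).
assert (H := is_series_half (fun k => residue_term x k t) (fun j => 4 * residue_term (2 * x) j (t / 2)) _ _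
  ltac:(intros k Hk; unfold residue_term; replace (2 * k * (t / 2)) with (k * t) by field;
        field; nra) H1 H2).
replace (2 * x * (t / 2)) with (x * t) in H by field.
replace (PI * (2 * x)) with (2 * (PI * x)) in H by ring. rewrite sinh_double in H.
assert (E := cosh_sqr (PI * x)).
replace (- (PI ^ 2 * cosh (x * t) / cosh (PI * x) ^ 2)) with
 (4 * (PI ^ 2 * cosh (x * t) / (2 * sinh (PI * x) * cosh (PI * x)) ^ 2 - 1 / (2 * x) ^ 2) -
  (PI ^ 2 * cosh (x * t) / sinh (PI * x) ^ 2 - 1 / x ^ 2)); [exact H|].
transitivity (PI ^ 2 * cosh (x * t) * (1 - cosh (PI * x) ^ 2) / (sinh (PI * x) ^ 2 * cosh (PI * x) ^ 2)).
- field. lra.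
- replace (1 - cosh (PI * x) ^ 2) with (- sinh (PI * x) ^ 2) by (rewrite E; ring). field. lra.
Qed.

(** Rests on [2 coth (2 a) - coth a = tanh a]. *)
Lemma is_series_half_inv_add_sq (x : R) : 0 < x ->
  is_series (fun m => / (x ^ 2 + half m ^ 2)) (PI * tanh (PI * x) / (2 * x)).
Proof.
intros Hx. assert (Hpi := PI_RGT_0).
assert (Hs : 0 < sinh (PI * x)) by (apply sinh_pos; nra). assert (Hc := cosh_pos (PI * x)).
assert (H := is_series_half (fun k => / (x ^ 2 + k ^ 2)) (fun j => 4 * / ((2 * x) ^ 2 + j ^ 2)) _ _
  ltac:(intros k Hk; cbv beta; field; nra)
  (is_series_scal_R 4 _ _ (is_series_inv_add_sq (2 * x) ltac:(lra))) (is_series_inv_add_sq x Hx)).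
replace (PI * tanh (PI * x) / (2 * x)) with
 (4 * (PI * coth (PI * (2 * x)) / (2 * (2 * x)) - 1 / (2 * (2 * x) ^ 2)) -
  (PI * coth (PI * x) / (2 * x) - 1 / (2 * x ^ 2))); [exact H|].
unfold coth, tanh. replace (PI * (2 * x)) with (2 * (PI * x)) by ring.
rewrite sinh_double, cosh_double.
transitivity (PI / (2 * x) * ((1 + 2 * sinh (PI * x) ^ 2 - cosh (PI * x) ^ 2)
   / (sinh (PI * x) * cosh (PI * x)))).
- field. lra.
- rewrite cosh_sqr. field. lra.
Qed.

(* At [t = 0], [residue_term] is [2 (x^2 - k^2) / (x^2 + k^2)^2]. *)
Lemma is_series_inv_add_sq_sq (k : nat -> R) (x W Q : R) : 0 < x -> (forall m, 0 < k m) ->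
  is_series (fun m => residue_term x (k m) 0) W -> is_series (fun m => / (x ^ 2 + k m ^ 2)) Q ->
  is_series (fun m => / (x ^ 2 + k m ^ 2) ^ 2) ((W + 2 * Q) / (4 * x ^ 2)).
Proof.
intros Hx Hk HW HQ.
assert (H := is_series_scal_R (/ (4 * x ^ 2)) _ _
  (is_series_plus_R _ _ _ _ HW (is_series_scal_R 2 _ _ HQ))).
unfold Rdiv. rewrite Rmult_comm. apply is_series_ext_R with (2 := H).
intros m. specialize (Hk m). unfold residue_term. rewrite !Rmult_0_r, cos_0, sin_0. field. nra.
Qed.

(** The weight [4] of the even terms matches the degree in [t], so the [t ^ 2] terms cancel; in the
    quartic analogue the weight [16] removes [t ^ 4] likewise. *)
Lemma is_series_half_cos2_sin1 (t : R) : Rabs t < 2 * PI ->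
  is_series (fun m => cos (half m * t) / half m ^ 2 + t * (sin (half m * t) / half m))
    (PI ^ 2 / 2).
Proof.
intros Ht.
assert (Ht2 : Rabs (t / 2) < 2 * PI).
{ apply Rabs_def2 in Ht. generalize PI_RGT_0. intros. apply Rabs_def1; lra. }
assert (H := is_series_half (fun k => cos (k * t) / k ^ 2 + t * (sin (k * t) / k))
  (fun j => 4 * (cos (j * (t / 2)) / j ^ 2 + t / 2 * (sin (j * (t / 2)) / j))) _ _
  ltac:(intros k Hk; cbv beta; replace (2 * k * (t / 2)) with (k * t) by field; field; lra)
  (is_series_scal_R 4 _ _ (is_series_cos2_sin1 _ Ht2)) (is_series_cos2_sin1 _ Ht)).
replace (PI ^ 2 / 2) with
  (4 * (PI ^ 2 / 6 - (t / 2) ^ 2 / 4) - (PI ^ 2 / 6 - t ^ 2 / 4)) by field.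
exact H.
Qed.

Lemma is_series_half_cos4_sin3 (t : R) : Rabs t < 2 * PI ->
  is_series (fun m => 3 * (cos (half m * t) / half m ^ 4) + t * (sin (half m * t) / half m ^ 3))
    (PI ^ 4 / 2 - PI ^ 2 * t ^ 2 / 4).
Proof.
intros Ht.
assert (Ht2 : Rabs (t / 2) < 2 * PI).
{ apply Rabs_def2 in Ht. generalize PI_RGT_0. intros. apply Rabs_def1; lra. }
assert (H := is_series_half (fun k => 3 * (cos (k * t) / k ^ 4) + t * (sin (k * t) / k ^ 3))
  (fun j => 16 * (3 * (cos (j * (t / 2)) / j ^ 4) + t / 2 * (sin (j * (t / 2)) / j ^ 3))) _ _
  ltac:(intros k Hk; cbv beta; replace (2 * k * (t / 2)) with (k * t) by field; field; lra)
  (is_series_scal_R 16 _ _ (is_series_cos4_sin3 _ Ht2)) (is_series_cos4_sin3 _ Ht)).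
replace (PI ^ 4 / 2 - PI ^ 2 * t ^ 2 / 4) with
  (16 * (PI ^ 4 / 30 - PI ^ 2 * (t / 2) ^ 2 / 12 + (t / 2) ^ 4 / 48)
   - (PI ^ 4 / 30 - PI ^ 2 * t ^ 2 / 12 + t ^ 4 / 48)) by field.
exact H.
Qed.

Lemma is_series_inv_sq : is_series (fun m => / INR (S m) ^ 2) (PI ^ 2 / 6).
Proof.
replace (PI ^ 2 / 6) with (cos_series 2 0)
  by (rewrite cos_series_2 by (generalize PI_RGT_0; lra); field).
apply is_series_ext_R with (2 := Series_correct _ (ex_cos_series 0 0)).
intros m. rewrite Rmult_0_r, cos_0. apply Rmult_1_l.
Qed.

Lemma is_series_inv_pow4 : is_series (fun m => / INR (S m) ^ 4) (PI ^ 4 / 90).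
Proof.
rewrite <- cos_series_4_0.
apply is_series_ext_R with (2 := Series_correct _ (ex_cos_series 2 0)).
intros m. rewrite Rmult_0_r, cos_0. apply Rmult_1_l.
Qed.

Lemma is_series_half_inv_sq : is_series (fun m => / half m ^ 2) (PI ^ 2 / 2).
Proof.
replace (PI ^ 2 / 2) with (4 * (PI ^ 2 / 6) - PI ^ 2 / 6) by field.
apply (is_series_half (fun k => / k ^ 2) (fun j => 4 * / j ^ 2)).
- intros k Hk. field. lra.
- apply is_series_scal_R, is_series_inv_sq.
- apply is_series_inv_sq.
Qed.

Lemma is_series_half_inv_pow4 : is_series (fun m => / half m ^ 4) (PI ^ 4 / 6).
Proof.
replace (PI ^ 4 / 6) with (16 * (PI ^ 4 / 90) - PI ^ 4 / 90) by field.
apply (is_series_half (fun k => / k ^ 4) (fun j => 16 * / j ^ 4)).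
- intros k Hk. field. lra.
- apply is_series_scal_R, is_series_inv_pow4.
- apply is_series_inv_pow4.
Qed.

(** * Exchange of the two summations *)

Lemma is_series_sum_n (a : nat -> nat -> R) (l : nat -> R) (N : nat) :
  (forall n, is_series (a n) (l n)) ->
  is_series (fun m => sum_n (fun n => a n m) N) (sum_n l N).
Proof.
intros H. induction N as [|N IH].
- rewrite sum_O. apply is_series_ext_R with (2 := H 0%nat). intros m. now rewrite sum_O.
- rewrite sum_Sn_R. apply is_series_ext_R with (2 := is_series_plus_R _ _ _ _ IH (H (S N))).
  intros m. now rewrite sum_Sn_R.
Qed.

Lemma Rabs_sum_n_le_series (a b : nat -> R) (l : R) (N : nat) :
  (forall n, Rabs (a n) <= b n) -> is_series b l -> Rabs (sum_n a N) <= l.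
Proof.
intros Hab Hb. apply Rle_trans with (sum_n b N).
- induction N as [|N IH]; [rewrite !sum_O; apply Hab|].
  rewrite !sum_Sn_R. eapply Rle_trans; [apply Rabs_triang|]. specialize (Hab (S N)). lra.
- apply (is_lim_seq_incr_compare (sum_n b) l Hb).
  intros n. rewrite sum_Sn_R. generalize (Hab (S n)) (Rabs_pos (a (S n))). lra.
Qed.

(** In contrast with [kernel_term_bound], the decay in [x] is kept: for fixed [k] the majorant can
    be summed over the lattice of [x]. *)
Lemma kernel_term_bound_product (x k t : R) : 0 < k ->
  Rabs (kernel_term x k t) <= (6 / k ^ 2 + 2 * Rabs t / k) * / (x ^ 2 + k ^ 2).
Proof.
intros Hk. assert (HD := sq_add_pos x k Hk). assert (Hk2 : 0 < k ^ 2) by nra.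
assert (Hi := Rinv_0_lt_compat _ HD).
assert (W1 : 0 <= / (k ^ 2 * (x ^ 2 + k ^ 2)) + 2 * / (x ^ 2 + k ^ 2) ^ 2
   <= 3 * / (k ^ 2 * (x ^ 2 + k ^ 2))).
{ assert (0 < / (x ^ 2 + k ^ 2) ^ 2) by (apply Rinv_0_lt_compat; nra).
  assert (0 < / (k ^ 2 * (x ^ 2 + k ^ 2))) by (apply Rinv_0_lt_compat; nra).
  assert (/ (x ^ 2 + k ^ 2) ^ 2 <= / (k ^ 2 * (x ^ 2 + k ^ 2))).
  { apply Rinv_le_contravar; nra. }
  lra. }
assert (W2 : 0 <= / (k * (x ^ 2 + k ^ 2)) <= / (k * (x ^ 2 + k ^ 2))).
{ split; [|lra]. left. apply Rinv_0_lt_compat. nra. }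
unfold kernel_term. eapply Rle_trans; [apply Rabs_triang|].
assert (B1 := lin_bound 2 _ _ _ (Rabs_cos_le (k * t)) W1).
assert (B2 := lin_bound (2 * t) _ _ _ (Rabs_sin_le (k * t)) W2).
rewrite (Rabs_mult 2 t), (Rabs_pos_eq 2) in B2 by lra. rewrite (Rabs_pos_eq 2) in B1 by lra.
replace ((6 / k ^ 2 + 2 * Rabs t / k) * / (x ^ 2 + k ^ 2))
  with (2 * (3 * / (k ^ 2 * (x ^ 2 + k ^ 2))) + 2 * Rabs t * / (k * (x ^ 2 + k ^ 2)))
  by (field; lra).
lra.
Qed.

(** The hypothesis [INR (S m) <= 2 * k m] is the growth condition shared by the integers and the
    half-integers. *)
Lemma inv_lattice_le (k : nat -> R) (m : nat) : INR (S m) <= 2 * k m ->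
  0 < / k m <= 2 / INR (S m).
Proof.
intros H. assert (Hm := INR_S_ge_1 m). split; [apply Rinv_0_lt_compat; lra|].
replace (2 / INR (S m)) with (/ (INR (S m) / 2)) by (field; lra).
apply Rinv_le_contravar; lra.
Qed.

(** The terms [kernel_term (x n) (k m) t] form a double series: summed over [m] they give
    [(W n + 2 e) / x n ^ 2], summed over [n] they give [U m]. Tannery's theorem, applied to the
    partial sums over [n], equates the two iterated sums; removing the Bernoulli share leaves
    [- 2 e Z]. *)
Lemma series_swap (x k : nat -> R) (t C e Z : R) (W Q Q2 : nat -> R) :
  (forall n, 0 < x n) -> (forall m, INR (S m) <= 2 * k m) ->
  (forall n, is_series (fun m => residue_term (x n) (k m) t) (W n)) ->
  is_series (fun m => cos (k m * t) / k m ^ 2 + t * (sin (k m * t) / k m)) e ->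
  is_series (fun n => / x n ^ 2) Z ->
  (forall m, is_series (fun n => / (x n ^ 2 + k m ^ 2)) (Q m)) ->
  (forall m, is_series (fun n => / (x n ^ 2 + k m ^ 2) ^ 2) (Q2 m)) ->
  (forall m, Q m <= C / k m) ->
  is_series (fun n => W n / x n ^ 2)
   (Series (fun m => 2 * (cos (k m * t) * (Q m / k m ^ 2 + 2 * Q2 m))
                     + 2 * t * (sin (k m * t) * (Q m / k m))) - 2 * e * Z).
Proof.
intros Hx Hk HW He HZ HQ HQ2 HQC.
set (U := fun m => 2 * (cos (k m * t) * (Q m / k m ^ 2 + 2 * Q2 m))
                     + 2 * t * (sin (k m * t) * (Q m / k m))).
assert (Hk0 : forall m, 0 < k m).
{ intros m. generalize (Hk m) (INR_S_ge_1 m). lra. }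
assert (HU : forall m, is_series (fun n => kernel_term (x n) (k m) t) (U m)).
{ intros m. specialize (Hk0 m).
  assert (H := is_series_plus_R _ _ _ _
    (is_series_scal_R (2 * cos (k m * t)) _ _
       (is_series_plus_R _ _ _ _ (is_series_scal_R (/ k m ^ 2) _ _ (HQ m))
                                 (is_series_scal_R 2 _ _ (HQ2 m))))
    (is_series_scal_R (2 * t * sin (k m * t) / k m) _ _ (HQ m))).
  replace (U m) with (2 * cos (k m * t) * (/ k m ^ 2 * Q m + 2 * Q2 m)
    + 2 * t * sin (k m * t) / k m * Q m) by (unfold U; field; lra).
  apply is_series_ext_R with (2 := H). intros n. unfold kernel_term. field. nra. }
assert (HV : forall n, is_series (fun m => kernel_term (x n) (k m) t) ((W n + 2 * e) / x n ^ 2)).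
{ intros n. specialize (Hx n).
  assert (H := is_series_scal_R (/ x n ^ 2) _ _
    (is_series_plus_R _ _ _ _ (HW n) (is_series_scal_R 2 _ _ He))).
  unfold Rdiv. rewrite Rmult_comm. apply is_series_ext_R with (2 := H).
  intros m. specialize (Hk0 m). unfold kernel_term, residue_term. field. nra. }
(* With [q = 1 / (m + 1)] and [1 / k m <= 2 q], the factor [c] is at most [(24 + 4 |t|) q] and [Q m]
   at most [2 |C| q]; their product is the majorant. *)
destruct (dominated_series eventually (fun N m => sum_n (fun n => kernel_term (x n) (k m) t) N) U
  (fun m => (48 + 8 * Rabs t) * Rabs C / INR (S m) ^ 2)) as [_ Hlim].
- exists 0%nat. intros N _ m. assert (Hkm := Hk0 m). assert (Hm := INR_S_ge_1 m).
  assert (Hinv := inv_lattice_le k m (Hk m)).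
  assert (Ht := Rabs_pos t). assert (HC := Rle_abs C). assert (HC0 := Rabs_pos C).
  set (c := 6 / k m ^ 2 + 2 * Rabs t / k m).
  apply Rle_trans with (c * Q m).
  + apply Rabs_sum_n_le_series with (fun n => c * / (x n ^ 2 + k m ^ 2)).
    * intros n. now apply kernel_term_bound_product.
    * apply is_series_scal_R, HQ.
  + set (q := / INR (S m)).
    assert (Hq : 0 < q <= 1).
    { unfold q. split; [apply Rinv_0_lt_compat; lra|].
      rewrite <- Rinv_1. apply Rinv_le_contravar; lra. }
    assert (Hik : 0 < / k m <= 2 * q) by exact Hinv.
    assert (Hc : 0 <= c <= (24 + 4 * Rabs t) * q).
    { unfold c. replace (6 / k m ^ 2) with (6 * (/ k m * / k m)) by (field; lra).
      replace (2 * Rabs t / k m) with (2 * Rabs t * / k m) by (field; lra).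
      assert (0 <= / k m * / k m <= 2 * q * (2 * q)).
      { split; [nra|]. apply Rmult_le_compat; lra. }
      assert (0 <= Rabs t * / k m <= Rabs t * (2 * q)).
      { split; [apply Rmult_le_pos; lra|]. apply Rmult_le_compat_l; lra. }
      assert (q * q <= q * 1) by (apply Rmult_le_compat_l; lra).
      lra. }
    replace ((48 + 8 * Rabs t) * Rabs C / INR (S m) ^ 2)
      with ((24 + 4 * Rabs t) * q * (Rabs C * (2 * q))) by (unfold q; field; lra).
    apply Rle_trans with (c * (Rabs C * (2 * q))).
    * apply Rmult_le_compat_l; [lra|]. apply Rle_trans with (1 := HQC m).
      unfold Rdiv. apply Rle_trans with (Rabs C * / k m).
      apply Rmult_le_compat_r; lra. apply Rmult_le_compat_l; lra.
    * apply Rmult_le_compat_r; [|lra]. apply Rmult_le_pos; lra.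
- apply ex_series_scal_R, ex_series_inv_sq.
- intros m. exact (HU m).
- assert (Hsum : is_series (fun n => (W n + 2 * e) / x n ^ 2) (Series U)).
  { apply is_series_Reals_lim.
    apply is_lim_seq_ext with (2 := Hlim). intros N.
    apply is_series_unique, is_series_sum_n, HV. }
  apply is_series_ext_R with (2 := is_series_minus_R _ _ _ _ Hsum (is_series_scal_R (2 * e) _ _ HZ)).
  intros n. field. apply Rgt_not_eq, Hx.
Qed.

(** * The four identities *)

Lemma ex_series_lattice (k c : nat -> R) (C : R) (p : nat) :
  (forall m, INR (S m) <= 2 * k m) -> (forall m, Rabs (c m) <= C) ->
  ex_series (fun m => c m / k m ^ (p + 2)).
Proof.
intros Hk Hc. apply ex_series_sq_bound with (C * 2 ^ (p + 2)). intros m.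
assert (Hm := INR_S_ge_1 m). assert (Hi := inv_lattice_le k m (Hk m)).
unfold Rdiv. rewrite Rabs_mult, Rmult_assoc.
apply Rmult_le_compat; [apply Rabs_pos|apply Rabs_pos|apply Hc|].
rewrite <- pow_inv. rewrite Rabs_pos_eq by (apply pow_le; lra).
apply Rle_trans with ((2 / INR (S m)) ^ (p + 2)); [apply pow_incr; lra|].
unfold Rdiv. rewrite Rpow_mult_distr. apply Rmult_le_compat_l; [apply pow_le; lra|].
rewrite pow_inv. apply inv_pow_le_inv_sq.
Qed.

Lemma Rabs_mult_le (a b A : R) : Rabs a <= A -> Rabs b <= 1 -> Rabs (a * b) <= A.
Proof.
intros Ha Hb. rewrite Rabs_mult. generalize (Rabs_pos a) (Rabs_pos b). nra.
Qed.

(** Common form for both lattices of [x]. The pair [tau], [sigma] stands for [coth], [1 / sinh ^ 2]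
    or [tanh], [1 / cosh ^ 2]; [s] is the sign of the latter in the closed form, and [d] accounts
    for the missing term at zero. Collecting the [d] terms yields the combination
    [3 cos / k ^ 4 + t sin / k ^ 3] summed by [e4]. *)
Lemma lattice_identity (x k : nat -> R) (t e e4 Z d s : R) (W tau sigma : nat -> R) :
  (forall n, 0 < x n) -> (forall m, INR (S m) <= 2 * k m) -> 0 <= d ->
  (forall m, Rabs (tau m) <= 2) -> (forall m, Rabs (sigma m) <= 2) ->
  (forall n, is_series (fun m => residue_term (x n) (k m) t) (W n)) ->
  is_series (fun m => cos (k m * t) / k m ^ 2 + t * (sin (k m * t) / k m)) e ->
  is_series (fun m => 3 * (cos (k m * t) / k m ^ 4) + t * (sin (k m * t) / k m ^ 3)) e4 ->
  is_series (fun n => / x n ^ 2) Z ->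
  (forall m, is_series (fun n => / (x n ^ 2 + k m ^ 2))
     (PI * tau m / (2 * k m) - d / (2 * k m ^ 2))) ->
  (forall m, is_series (fun n => / (x n ^ 2 + k m ^ 2) ^ 2)
     (s * PI ^ 2 * sigma m / (4 * k m ^ 2) + PI * tau m / (4 * k m ^ 3) - d / (2 * k m ^ 4))) ->
  exists B C D,
    is_series (fun m => sigma m * cos (k m * t) / k m ^ 2) B /\
    is_series (fun m => tau m * sin (k m * t) / k m ^ 2) C /\
    is_series (fun m => tau m * cos (k m * t) / k m ^ 3) D /\
    is_series (fun n => W n / x n ^ 2)
      (2 * PI * D + s * PI ^ 2 * B + t * PI * C - d * e4 - 2 * e * Z).
Proof.
intros Hx Hk Hd Htau Hsigma HW He He4 HZ HS HT. assert (Hpi := PI_RGT_0).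
assert (Hk0 : forall m, 0 < k m).
{ intros m. generalize (Hk m) (INR_S_ge_1 m). lra. }
assert (HB : ex_series (fun m => sigma m * cos (k m * t) / k m ^ 2)).
{ apply (ex_series_lattice k (fun m => sigma m * cos (k m * t)) 2 0 Hk).
  intros m. apply Rabs_mult_le; [apply Hsigma|apply Rabs_cos_le]. }
assert (HC : ex_series (fun m => tau m * sin (k m * t) / k m ^ 2)).
{ apply (ex_series_lattice k (fun m => tau m * sin (k m * t)) 2 0 Hk).
  intros m. apply Rabs_mult_le; [apply Htau|apply Rabs_sin_le]. }
assert (HD : ex_series (fun m => tau m * cos (k m * t) / k m ^ 3)).
{ apply (ex_series_lattice k (fun m => tau m * cos (k m * t)) 2 1 Hk).
  intros m. apply Rabs_mult_le; [apply Htau|apply Rabs_cos_le]. }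
destruct HB as [B HB], HC as [C HC], HD as [D HD].
exists B, C, D. split; [exact HB|split; [exact HC|split; [exact HD|]]].
(* From [tau m <= 2] and [0 <= d], the constant required by the exchange can be [PI]. *)
assert (HSC : forall m, PI * tau m / (2 * k m) - d / (2 * k m ^ 2) <= PI / k m).
{ intros m. specialize (Hk0 m). specialize (Htau m).
  assert (Ht := Rle_trans _ _ _ (Rle_abs _) Htau).
  assert (0 <= d / (2 * k m ^ 2)).
  { apply Rmult_le_pos; [exact Hd|]. left. apply Rinv_0_lt_compat. nra. }
  replace (PI * tau m / (2 * k m)) with (PI * (tau m / 2) / k m) by (field; lra).
  assert (PI * (tau m / 2) / k m <= PI / k m).
  { apply Rmult_le_compat_r; [left; now apply Rinv_0_lt_compat|]. nra. }
  lra. }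
assert (H := series_swap x k t PI e Z W _ _ Hx Hk HW He HZ HS HT HSC).
replace (2 * PI * D + s * PI ^ 2 * B + t * PI * C - d * e4) with
 (Series (fun m : nat => 2 * (cos (k m * t) *
      ((PI * tau m / (2 * k m) - d / (2 * k m ^ 2)) / k m ^ 2 +
       2 * (s * PI ^ 2 * sigma m / (4 * k m ^ 2) + PI * tau m / (4 * k m ^ 3) - d / (2 * k m ^ 4)))) +
   2 * t * (sin (k m * t) * ((PI * tau m / (2 * k m) - d / (2 * k m ^ 2)) / k m)))); [exact H|].
apply is_series_unique.
assert (H' := is_series_minus_R _ _ _ _ (is_series_plus_R _ _ _ _ (is_series_plus_R _ _ _ _
  (is_series_scal_R (2 * PI) _ _ HD) (is_series_scal_R (s * PI ^ 2) _ _ HB))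
  (is_series_scal_R (t * PI) _ _ HC)) (is_series_scal_R d _ _ He4)).
apply is_series_ext_R with (2 := H'). intros m. field. apply Rgt_not_eq, Hk0.
Qed.

(** [y >= 1] gives [exp y >= 2] and [exp (- y) <= 1 / 2], hence half their difference is at least
    [3 / 4]. This suffices for all coefficient bounds by [2]. *)
Lemma sinh_ge (k : R) : 1 / 2 <= k -> 3 / 4 <= sinh (PI * k).
Proof.
intros Hk. assert (Hy : 1 <= PI * k) by (generalize PI2_1; nra).
set (y := PI * k) in *. assert (H1 := exp_ineq1_le y).
assert (H2 : exp (- y) <= / 2).
{ rewrite exp_Ropp. apply Rinv_le_contravar; lra. }
unfold sinh. lra.
Qed.

Lemma coth_bound (k : R) : 1 / 2 <= k -> Rabs (coth (PI * k)) <= 2.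
Proof.
intros Hk. assert (Hs := sinh_ge k Hk). assert (Hc := cosh_pos (PI * k)).
assert (E := cosh_sqr (PI * k)). unfold coth.
rewrite Rabs_pos_eq by (apply Rmult_le_pos; [lra|left; apply Rinv_0_lt_compat; lra]).
apply Rmult_le_reg_r with (sinh (PI * k)); [lra|]. unfold Rdiv.
rewrite Rmult_assoc, Rinv_l by lra. nra.
Qed.

Lemma tanh_bound (k : R) : 1 / 2 <= k -> Rabs (tanh (PI * k)) <= 2.
Proof.
intros Hk. assert (Hs := sinh_ge k Hk). assert (Hc := cosh_pos (PI * k)).
assert (E := cosh_sqr (PI * k)). unfold tanh.
rewrite Rabs_pos_eq by (apply Rmult_le_pos; [lra|left; apply Rinv_0_lt_compat; lra]).
apply Rmult_le_reg_r with (cosh (PI * k)); [lra|]. unfold Rdiv.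
rewrite Rmult_assoc, Rinv_l by lra. nra.
Qed.

Lemma inv_sqr_bound (a : R) : 3 / 4 <= a -> Rabs (/ a ^ 2) <= 2.
Proof.
intros Ha. assert (0 < a ^ 2) by nra.
rewrite Rabs_pos_eq by (left; now apply Rinv_0_lt_compat).
replace 2 with (/ (1 / 2)) by field. apply Rinv_le_contravar; nra.
Qed.

Lemma lattice_ge_half (k : nat -> R) (m : nat) : INR (S m) <= 2 * k m -> 1 / 2 <= k m.
Proof. generalize (INR_S_ge_1 m). lra. Qed.

(** Here [x] runs over the positive integers, so [d = 1] and [s = 1], while [k] may be either
    lattice. The last coefficient is [2 * zeta 2 = PI ^ 2 / 3]. *)
Lemma identity_over_integers (k : nat -> R) (t e e4 : R) (W : nat -> R) :
  (forall m, INR (S m) <= 2 * k m) ->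
  (forall n, is_series (fun m => residue_term (INR (S n)) (k m) t) (W n)) ->
  is_series (fun m => cos (k m * t) / k m ^ 2 + t * (sin (k m * t) / k m)) e ->
  is_series (fun m => 3 * (cos (k m * t) / k m ^ 4) + t * (sin (k m * t) / k m ^ 3)) e4 ->
  exists B C D,
    is_series (fun m => / sinh (PI * k m) ^ 2 * cos (k m * t) / k m ^ 2) B /\
    is_series (fun m => coth (PI * k m) * sin (k m * t) / k m ^ 2) C /\
    is_series (fun m => coth (PI * k m) * cos (k m * t) / k m ^ 3) D /\
    is_series (fun n => W n / INR (S n) ^ 2)
      (2 * PI * D + PI ^ 2 * B + t * PI * C - e4 - PI ^ 2 / 3 * e).
Proof.
intros Hk HW He He4. assert (Hpi := PI_RGT_0).
assert (HS : forall m, is_series (fun n => / (k m ^ 2 + INR (S n) ^ 2))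
   (PI * coth (PI * k m) / (2 * k m) - 1 / (2 * k m ^ 2))).
{ intros m. apply is_series_inv_add_sq. generalize (lattice_ge_half k m (Hk m)). lra. }
destruct (lattice_identity (fun n => INR (S n)) k t e e4 (PI ^ 2 / 6) 1 1 W
  (fun m => coth (PI * k m)) (fun m => / sinh (PI * k m) ^ 2)) as [B [C [D [HB [HC [HD H]]]]]].
- intros n. generalize (INR_S_ge_1 n). lra.
- exact Hk.
- lra.
- intros m. apply coth_bound, lattice_ge_half, Hk.
- intros m. apply inv_sqr_bound, sinh_ge, lattice_ge_half, Hk.
- exact HW.
- exact He.
- exact He4.
- apply is_series_inv_sq.
- intros m. apply is_series_ext_R with (2 := HS m). intros n. now rewrite Rplus_comm.
- intros m. assert (Hkm := lattice_ge_half k m (Hk m)). assert (Hs := sinh_ge _ Hkm).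
  (* The roles are exchanged: the expansion at [t = 0] is taken with parameter [k m] and summed over
     the lattice of [x]. *)
  assert (H2 := is_series_inv_add_sq_sq (fun n => INR (S n)) (k m) _ _ ltac:(lra)
    ltac:(intros n; generalize (INR_S_ge_1 n); lra)
    (is_series_residue_term (k m) ltac:(lra) 0 ltac:(rewrite Rabs_R0; lra)) (HS m)).
  replace (1 * PI ^ 2 * / sinh (PI * k m) ^ 2 / (4 * k m ^ 2) +
    PI * coth (PI * k m) / (4 * k m ^ 3) - 1 / (2 * k m ^ 4)) with
   ((PI ^ 2 * cosh (k m * 0) / sinh (PI * k m) ^ 2 - 1 / k m ^ 2 +
      2 * (PI * coth (PI * k m) / (2 * k m) - 1 / (2 * k m ^ 2))) / (4 * k m ^ 2)).
  + apply is_series_ext_R with (2 := H2). intros n. now rewrite Rplus_comm.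
  + rewrite Rmult_0_r, cosh_0. field. lra.
- exists B, C, D. split; [exact HB|split; [exact HC|split; [exact HD|]]].
  replace (2 * PI * D + PI ^ 2 * B + t * PI * C - e4 - PI ^ 2 / 3 * e) with
    (2 * PI * D + 1 * PI ^ 2 * B + t * PI * C - 1 * e4 - 2 * e * (PI ^ 2 / 6)) by field.
  exact H.
Qed.

(** Zero is not a half-integer, so no term is missing and [d = 0]; the sign [s = -1] comes from the
    closed form [- 1 / cosh ^ 2]. The last coefficient is twice [PI ^ 2 / 2]. *)
Lemma identity_over_half_integers (k : nat -> R) (t e e4 : R) (W : nat -> R) :
  (forall m, INR (S m) <= 2 * k m) ->
  (forall n, is_series (fun m => residue_term (half n) (k m) t) (W n)) ->
  is_series (fun m => cos (k m * t) / k m ^ 2 + t * (sin (k m * t) / k m)) e ->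
  is_series (fun m => 3 * (cos (k m * t) / k m ^ 4) + t * (sin (k m * t) / k m ^ 3)) e4 ->
  exists B C D,
    is_series (fun m => / cosh (PI * k m) ^ 2 * cos (k m * t) / k m ^ 2) B /\
    is_series (fun m => tanh (PI * k m) * sin (k m * t) / k m ^ 2) C /\
    is_series (fun m => tanh (PI * k m) * cos (k m * t) / k m ^ 3) D /\
    is_series (fun n => W n / half n ^ 2)
      (2 * PI * D - PI ^ 2 * B + t * PI * C - PI ^ 2 * e).
Proof.
intros Hk HW He He4. assert (Hpi := PI_RGT_0).
assert (HS : forall m, is_series (fun n => / (k m ^ 2 + half n ^ 2))
   (PI * tanh (PI * k m) / (2 * k m))).
{ intros m. apply is_series_half_inv_add_sq. generalize (lattice_ge_half k m (Hk m)). lra. }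
destruct (lattice_identity half k t e e4 (PI ^ 2 / 2) 0 (-1) W
  (fun m => tanh (PI * k m)) (fun m => / cosh (PI * k m) ^ 2)) as [B [C [D [HB [HC [HD H]]]]]].
- exact half_pos.
- exact Hk.
- lra.
- intros m. apply tanh_bound, lattice_ge_half, Hk.
- intros m. apply inv_sqr_bound.
  generalize (sinh_ge _ (lattice_ge_half k m (Hk m))) (cosh_pos (PI * k m)) (cosh_sqr (PI * k m)).
  nra.
- exact HW.
- exact He.
- exact He4.
- apply is_series_half_inv_sq.
- intros m. assert (Hkm := lattice_ge_half k m (Hk m)).
  replace (PI * tanh (PI * k m) / (2 * k m) - 0 / (2 * k m ^ 2)) with
    (PI * tanh (PI * k m) / (2 * k m)) by (field; lra).
  apply is_series_ext_R with (2 := HS m). intros n. now rewrite Rplus_comm.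
- intros m. assert (Hkm := lattice_ge_half k m (Hk m)). assert (Hs := sinh_ge _ Hkm).
  assert (Hc := cosh_pos (PI * k m)).
  assert (H2 := is_series_inv_add_sq_sq half (k m) _ _ ltac:(lra) half_pos
    (is_series_half_residue_term (k m) 0 ltac:(lra) ltac:(rewrite Rabs_R0; lra)) (HS m)).
  replace (-1 * PI ^ 2 * / cosh (PI * k m) ^ 2 / (4 * k m ^ 2) +
    PI * tanh (PI * k m) / (4 * k m ^ 3) - 0 / (2 * k m ^ 4)) with
   ((- (PI ^ 2 * cosh (k m * 0) / cosh (PI * k m) ^ 2) +
      2 * (PI * tanh (PI * k m) / (2 * k m))) / (4 * k m ^ 2)).
  + apply is_series_ext_R with (2 := H2). intros n. now rewrite Rplus_comm.
  + rewrite Rmult_0_r, cosh_0. field. lra.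
- exists B, C, D. split; [exact HB|split; [exact HC|split; [exact HD|]]].
  replace (2 * PI * D - PI ^ 2 * B + t * PI * C - PI ^ 2 * e) with
    (2 * PI * D + -1 * PI ^ 2 * B + t * PI * C - 0 * e4 - 2 * e * (PI ^ 2 / 2)) by field.
  exact H.
Qed.

Lemma is_series_scal_ext (c : R) (a b : nat -> R) (l : R) :
  (forall n, b n = c * a n) -> is_series a l -> is_series b (c * l).
Proof.
intros H Ha. apply is_series_ext_R with (2 := is_series_scal_R c _ _ Ha).
intros n. now rewrite H.
Qed.

Lemma INR_S_lattice (m : nat) : INR (S m) <= 2 * INR (S m).
Proof. generalize (INR_S_ge_1 m). lra. Qed.

(** The four identities are the four choices of integers or half-integers for [x] and for [k]. The
    sums of [cosh] run over [x], the trigonometric ones over [k]. *)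
Theorem theorem2p2 (theta : R) (htheta : Rabs theta < PI) :
  (exists A B C D : R,
      is_sum1 (fun n => cosh (INR n * theta) / (INR n ^ 2 * sinh (PI * INR n) ^ 2)) A /\
      is_sum1 (fun n => cos (INR n * theta) / (INR n ^ 2 * sinh (PI * INR n) ^ 2)) B /\
      is_sum1 (fun n => coth (PI * INR n) * sin (INR n * theta) / INR n ^ 2) C /\
      is_sum1 (fun n => coth (PI * INR n) * cos (INR n * theta) / INR n ^ 3) D /\
      PI ^ 2 * A - PI ^ 2 * B - theta * PI * C - 2 * PI * D
        + theta ^ 4 / 48 - theta ^ 2 * zeta 2 + 7 * zeta 4 = 0)
  /\
  (exists A B C D : R,
      is_sum1 (fun n => cosh ((2 * INR n - 1) / 2 * theta)
                 / ((2 * INR n - 1) ^ 2 * cosh ((2 * INR n - 1) / 2 * PI) ^ 2)) A /\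
      is_sum1 (fun n => cos ((2 * INR n - 1) / 2 * theta)
                 / ((2 * INR n - 1) ^ 2 * cosh ((2 * INR n - 1) / 2 * PI) ^ 2)) B /\
      is_sum1 (fun n => tanh ((2 * INR n - 1) / 2 * PI) * sin ((2 * INR n - 1) / 2 * theta)
                 / (2 * INR n - 1) ^ 2) C /\
      is_sum1 (fun n => tanh ((2 * INR n - 1) / 2 * PI) * cos ((2 * INR n - 1) / 2 * theta)
                 / (2 * INR n - 1) ^ 3) D /\
      PI ^ 2 * A - PI ^ 2 * B + theta * PI * C + 4 * PI * D - PI ^ 4 / 8 = 0)
  /\
  (exists A B C D : R,
      is_sum1 (fun n => cosh (INR n * theta) / (INR n ^ 2 * cosh (PI * INR n) ^ 2)) A /\
      is_sum1 (fun n => cos ((2 * INR n - 1) / 2 * theta)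
                 / ((2 * INR n - 1) ^ 2 * sinh ((2 * INR n - 1) / 2 * PI) ^ 2)) B /\
      is_sum1 (fun n => coth ((2 * INR n - 1) / 2 * PI) * sin ((2 * INR n - 1) / 2 * theta)
                 / (2 * INR n - 1) ^ 2) C /\
      is_sum1 (fun n => coth ((2 * INR n - 1) / 2 * PI) * cos ((2 * INR n - 1) / 2 * theta)
                 / (2 * INR n - 1) ^ 3) D /\
      PI ^ 2 * A + 4 * PI ^ 2 * B + 4 * theta * PI * C + 16 * PI * D
        + (theta ^ 2 / 4 - 4 * zeta 2) * PI ^ 2 = 0)
  /\
  (exists A B C D : R,
      is_sum1 (fun n => cos (INR n * theta) / (INR n ^ 2 * cosh (PI * INR n) ^ 2)) A /\
      is_sum1 (fun n => cosh ((2 * INR n - 1) / 2 * theta)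
                 / ((2 * INR n - 1) ^ 2 * sinh ((2 * INR n - 1) / 2 * PI) ^ 2)) B /\
      is_sum1 (fun n => tanh (PI * INR n) * sin (INR n * theta) / INR n ^ 2) C /\
      is_sum1 (fun n => tanh (PI * INR n) * cos (INR n * theta) / INR n ^ 3) D /\
      PI ^ 2 * A + 4 * PI ^ 2 * B - theta * PI * C - 2 * PI * D
        - PI ^ 2 * theta ^ 2 / 4 = 0).
Proof.
assert (Hpi := PI_RGT_0). assert (Ht : Rabs theta < 2 * PI) by lra.
assert (N0 : forall n, INR (S n) <> 0) by (intros n; generalize (INR_S_ge_1 n); lra).
assert (Np : forall n, 0 < INR (S n)) by (intros n; generalize (INR_S_ge_1 n); lra).
assert (O0 : forall n, 2 * INR (S n) - 1 <> 0) by (intros n; generalize (INR_S_ge_1 n); lra).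
assert (SN : forall n, sinh (PI * INR (S n)) <> 0).
{ intros n. apply Rgt_not_eq, sinh_pos, Rmult_lt_0_compat; auto. }
assert (SO : forall n, sinh (PI * half n) <> 0).
{ intros n. apply Rgt_not_eq, sinh_pos, Rmult_lt_0_compat; [lra|apply half_pos]. }
assert (CH : forall a, cosh a <> 0) by (intros a; apply Rgt_not_eq, cosh_pos).
assert (Hh : forall n, (2 * INR (S n) - 1) / 2 = half n) by reflexivity.
assert (H2h : forall n, 2 * INR (S n) - 1 = 2 * half n) by (intros n; unfold half; field).
assert (h0 : forall n, half n <> 0) by (intros n; apply Rgt_not_eq, half_pos).
rewrite zeta_2, zeta_4. unfold is_sum1.
split; [|split; [|split]].
- destruct (identity_over_integers (fun m => INR (S m)) theta _ _ _ INR_S_lattice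
    (fun n => is_series_residue_term (INR (S n)) (Np n) theta Ht)
    (is_series_cos2_sin1 theta Ht) (is_series_cos4_sin3 theta Ht))
    as [B [C [D [HB [HC [HD HA]]]]]].
  (* The [- 1 / x ^ 2] in [W] leaves [- 1 / x ^ 4] after division, which is added back here. The
     constants [PI ^ 4 / 90 - PI ^ 4 / 30 - PI ^ 4 / 18] then make up [- 7 * zeta 4]. *)
  assert (HA' := is_series_plus_R _ _ _ _ HA is_series_inv_pow4).
  eexists _, B, C, D. split; [|split; [|split; [|split]]].
  + apply is_series_scal_ext with (c := / PI ^ 2) (2 := HA').
    intros n. cbv beta. field. split; [|split]; auto; lra.
  + apply is_series_ext_R with (2 := HB). intros n. field. auto.
  + exact HC.
  + exact HD.
  + field. lra.
- destruct (identity_over_half_integers half theta _ _ _ half_ge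
    (fun n => is_series_half_residue_term (half n) theta (half_pos n) Ht)
    (is_series_half_cos2_sin1 theta Ht) (is_series_half_cos4_sin3 theta Ht))
    as [B [C [D [HB [HC [HD HA]]]]]].
  eexists _, _, _, _. split; [|split; [|split; [|split]]].
  (* The sign is that of [- 1 / cosh ^ 2]; the factors [4] here and [8] for the cubes convert
     [half n] to [2 n - 1]. *)
  + apply is_series_scal_ext with (c := - / (4 * PI ^ 2)) (2 := HA).
    intros n. cbv beta. rewrite Hh, H2h, (Rmult_comm _ PI). field. split; [|split]; auto; lra.
  + apply is_series_scal_ext with (c := / 4) (2 := HB).
    intros n. cbv beta. rewrite Hh, H2h, (Rmult_comm _ PI). field. auto.
  + apply is_series_scal_ext with (c := / 4) (2 := HC).
    intros n. cbv beta. rewrite Hh, H2h, (Rmult_comm _ PI). field. auto.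
  + apply is_series_scal_ext with (c := / 8) (2 := HD).
    intros n. cbv beta. rewrite Hh, H2h, (Rmult_comm _ PI). field. auto.
  + field. lra.
- destruct (identity_over_integers half theta _ _ _ half_ge
    (fun n => is_series_half_residue_term (INR (S n)) theta (Np n) Ht)
    (is_series_half_cos2_sin1 theta Ht) (is_series_half_cos4_sin3 theta Ht))
    as [B [C [D [HB [HC [HD HA]]]]]].
  eexists _, _, _, _. split; [|split; [|split; [|split]]].
  + apply is_series_scal_ext with (c := - / PI ^ 2) (2 := HA).
    intros n. cbv beta. field. split; [|split]; auto; lra.
  + apply is_series_scal_ext with (c := / 4) (2 := HB).
    intros n. cbv beta. rewrite Hh, H2h, (Rmult_comm _ PI). field. auto.
  + apply is_series_scal_ext with (c := / 4) (2 := HC).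
    intros n. cbv beta. rewrite Hh, H2h, (Rmult_comm _ PI). field. auto.
  + apply is_series_scal_ext with (c := / 8) (2 := HD).
    intros n. cbv beta. rewrite Hh, H2h, (Rmult_comm _ PI). field. auto.
  + field. lra.
- destruct (identity_over_half_integers (fun m => INR (S m)) theta _ _ _ INR_S_lattice
    (fun n => is_series_residue_term (half n) (half_pos n) theta Ht)
    (is_series_cos2_sin1 theta Ht) (is_series_cos4_sin3 theta Ht))
    as [B [C [D [HB [HC [HD HA]]]]]].
  (* The correction [PI ^ 4 / 6] cancels the constant part of [- PI ^ 2 * e], so only
     [PI ^ 2 * theta ^ 2 / 4] survives. *)
  assert (HA' := is_series_plus_R _ _ _ _ HA is_series_half_inv_pow4).
  eexists B, _, C, D. split; [|split; [|split; [|split]]].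
  + apply is_series_ext_R with (2 := HB). intros n. field. auto.
  + apply is_series_scal_ext with (c := / (4 * PI ^ 2)) (2 := HA').
    intros n. cbv beta. rewrite Hh, H2h, (Rmult_comm _ PI). field. split; [|split]; auto; lra.
  + exact HC.
  + exact HD.
  + field. lra.
Qed.
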